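(* There exist Legendrian knot types $\mathscr L$ (path components of the space of Legendrian knots in standard contact $\mathbf R^3$) such that, for the corresponding smooth knot type $\mathscr K\supset\mathscr L$ (the path component, in the space of smooth knots in $\mathbf R^3$, containing $\mathscr L$), the homomorphism $\pi_1(\mathscr L)\to\pi_1(\mathscr K)$ induced by the inclusion is not injective.
   Context: Standard contact $\mathbf R^3$ is $\mathbf R^3$ with the contact structure $\ker(dz-y\,dx)$. Knots are oriented and unparametrized (embedded circles). *)

(* Defs.v *)
From HB Require Import structures.
From mathcomp Require Import all_boot all_order all_algebra.
From mathcomp Require Import generic_quotient.
From mathcomp Require Import all_classical all_reals all_analysis.
From mathcomp Require Import homotopy.
From mathcomp Require Import lra.

Set Implicit Arguments.
Unset Strict Implicit.
Unset Printing Implicit Defensive.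

Import Order.TTheory GRing.Theory Num.Theory numFieldNormedType.Exports.

Local Open Scope classical_set_scope.
Local Open Scope ring_scope.
Local Open Scope quotient_scope.

Section UnitInterval.
Variable R : realType.

Definition unit_interval : Type := set_type (`[0, 1]%classic : set R).

HB.instance Definition _ := Topological.on unit_interval.

Definition ival (t : unit_interval) : R := set_val t.

Lemma clamp_subproof (x : R) :
  Num.max 0 (Num.min 1 x) \in (`[0, 1]%classic : set R).
Proof.
by rewrite inE /= in_itv /= le_max lexx /= ge_max ler01 ge_min lexx.
Qed.

Definition clamp (x : R) : unit_interval :=
  exist _ (Num.max 0 (Num.min 1 x)) (clamp_subproof x).

Lemma ival_ge0 t : 0 <= ival t.
Proof. by have := set_valP t; rewrite /= in_itv /= => /andP[]. Qed.

Lemma ival_le1 t : ival t <= 1.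
Proof. by have := set_valP t; rewrite /= in_itv /= => /andP[]. Qed.

Lemma ival_inj : injective ival.
Proof. exact: val_inj. Qed.

Lemma clampE x : 0 <= x <= 1 -> ival (clamp x) = x.
Proof. by move=> /andP[x0 x1]; rewrite /ival set_valE /= min_r// max_r. Qed.

Lemma ivalK t : clamp (ival t) = t.
Proof. by apply: ival_inj; rewrite clampE// ival_ge0 ival_le1. Qed.

Lemma ival_continuous : continuous ival.
Proof. exact: initial_continuous. Qed.

Lemma clamp_continuous : continuous clamp.
Proof.
apply: continuous_comp_initial => x.
apply: (@continuous_max _ _ (cst 0 : R -> R^o) (fun x => Num.min 1 x)).
  exact: cvg_cst.
apply: (@continuous_min _ _ (cst 1 : R -> R^o) (fun x => x)); last exact: cvg_id.
exact: cvg_cst.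
Qed.

Lemma clamp01_neq : clamp 0 != clamp 1.
Proof.
apply/eqP => /(congr1 ival); rewrite !clampE ?lexx ?ler01// => /eqP.
by rewrite eq_sym oner_eq0.
Qed.

HB.instance Definition _ := isBiPointed.Build unit_interval clamp01_neq.

Lemma ival0 : ival zero = 0. Proof. by rewrite clampE// lexx ler01. Qed.

Lemma ival1 : ival one = 1. Proof. by rewrite clampE// lexx ler01. Qed.

End UnitInterval.

Notation path01 R x y := {path unit_interval R from x to y}.

Section PathComponents.
Variables (R : realType) (T : topologicalType).

Definition path_component (x : T) : set T :=
  [set y | inhabited (path01 R x y)].

Definition is_path_component (A : set T) : Prop :=
  exists x, A = path_component x.

End PathComponents.

Section Gluing.
Variables (R : realType) (X T : topologicalType).

Lemma glue_continuous (c : X -> R) (a : R) (f g : X -> T) :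
  continuous c -> continuous f -> continuous g ->
  (forall x, c x = a -> f x = g x) ->
  continuous (fun x => if c x <= a then f x else g x).
Proof.
move=> cc cf cg fg; apply/continuous_subspace_setT.
have -> : [set: X] = (c @^-1` [set x | x <= a]) `|` (c @^-1` [set x | a <= x]).
  by apply/seteqP; split => // x _ /=; case: (leP (c x) a) => h; [left|right; exact: ltW].
apply: withinU_continuous.
- by apply: closed_comp => [x _|]; [exact: cc|exact: closed_le].
- by apply: closed_comp => [x _|]; [exact: cc|exact: closed_ge].
- apply: (@subspace_eq_continuous _ _ _ f) => [x|].
    by move=> /set_mem /= h; rewrite /from_subspace h.
  exact: continuous_subspaceT.
- apply: (@subspace_eq_continuous _ _ _ g) => [x|].
    move=> /set_mem /= h; rewrite /from_subspace; case: ifPn => // h'; apply/esym/fg/le_anti.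
    by rewrite h h'.
  exact: continuous_subspaceT.
Qed.

End Gluing.

Section ContinuityFacts.
Variables X Y Z : topologicalType.

Lemma continuous_comp2 (f : X -> Y) (g : Y -> Z) :
  continuous g -> continuous f -> continuous (fun x => g (f x)).
Proof. by move=> cg cf x; exact: (continuous_comp (cf x) (cg (f x))). Qed.

Lemma continuous_pair (f : X -> Y) (g : X -> Z) :
  continuous f -> continuous g -> continuous (fun x => (f x, g x)).
Proof. by move=> cf cg x; apply: cvg_pair; [exact: cf|exact: cg]. Qed.

Lemma continuous_fst (f : X -> Y * Z) :
  continuous f -> continuous (fun x => (f x).1).
Proof. by move=> cf x; apply: (continuous_comp (cf x)); exact: cvg_fst. Qed.

Lemma continuous_snd (f : X -> Y * Z) :
  continuous f -> continuous (fun x => (f x).2).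
Proof. by move=> cf x; apply: (continuous_comp (cf x)); exact: cvg_snd. Qed.

Lemma continuous_idfun : continuous (fun x : X => x).
Proof. by move=> x; exact: cvg_id. Qed.

End ContinuityFacts.

Section RealContinuityFacts.
Variables (R : realType) (X : topologicalType).
Implicit Types (f g : X -> R).

Lemma continuous_cst0 (a : R) : continuous (fun _ : X => a).
Proof. by move=> x; exact: cvg_cst. Qed.

Lemma continuous_add f g :
  continuous f -> continuous g -> continuous (fun x => f x + g x).
Proof. by move=> cf cg x; apply: (@continuousD _ R^o _ f g); [exact: cf|exact: cg]. Qed.

Lemma continuous_opp f : continuous f -> continuous (fun x => - f x).
Proof. by move=> cf x; apply: (@continuousN _ R^o _ f); exact: cf. Qed.

Lemma continuous_mul f g :
  continuous f -> continuous g -> continuous (fun x => f x * g x).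
Proof. by move=> cf cg x; apply: (@continuousM _ _ f g); [exact: cf|exact: cg]. Qed.

Lemma continuous_minr f g :
  continuous f -> continuous g -> continuous (fun x => Num.min (f x) (g x)).
Proof. by move=> cf cg x; apply: (@continuous_min _ _ f g); [exact: cf|exact: cg]. Qed.

Lemma continuous_clamp f : continuous f -> continuous (fun x => clamp (f x)).
Proof. exact/continuous_comp2/clamp_continuous. Qed.

Lemma continuous_ival (h : X -> unit_interval R) :
  continuous h -> continuous (fun x => ival (h x)).
Proof. exact/continuous_comp2/ival_continuous. Qed.

End RealContinuityFacts.

Ltac cts := repeat lazymatch goal with
  | |- continuous (fun x => @?f x + @?g x) => apply: (@continuous_add _ _ f g)
  | |- continuous (fun x => - @?f x) => apply: (@continuous_opp _ _ f)
  | |- continuous (fun x => @?f x * @?g x) => apply: (@continuous_mul _ _ f g)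
  | |- continuous (fun x => Order.min (@?f x) (@?g x)) =>
      apply: (@continuous_minr _ _ f g)
  | |- continuous (fun x => clamp (@?f x)) => apply: (@continuous_clamp _ _ f)
  | |- continuous (fun x => ival (@?f x)) => apply: (@continuous_ival _ _ f)
  | |- continuous (fun x => (@?f x, @?g x)) =>
      apply: (@continuous_pair _ _ _ f g)
  | |- continuous (fun x => (@?f x).1) => apply: (@continuous_fst _ _ _ f)
  | |- continuous (fun x => (@?f x).2) => apply: (@continuous_snd _ _ _ f)
  | |- continuous (fun _ => ?c) => exact: continuous_cst0
  | |- continuous (fun x => x) => exact: continuous_idfun
  | |- continuous (@ival _) => exact: ival_continuous
  | |- continuous (fun x => ?h (@?f x)) => apply: (@continuous_comp2 _ _ _ f h)
  | |- continuous _ => first [assumption | exact: cts_fun]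
  end.

Ltac case_min := repeat match goal with
  | |- context [Order.min ?a ?b] =>
    lazymatch b with
    | context [Order.min _ _] => fail
    | _ => case: (leP a b) => ?
    end
  end.

Section Homotopy.
Variables (R : realType) (T : topologicalType).
Local Notation I := (unit_interval R).

Definition homotopic (x y : T) (p q : path01 R x y) : Prop :=
  exists H : I * I -> T, [/\ continuous H,
    forall t, H (t, zero) = p t, forall t, H (t, one) = q t &
    forall s, H (zero, s) = x /\ H (one, s) = y].

Lemma homotopic_refl (x y : T) (p : path01 R x y) : homotopic p p.
Proof.
exists (fun ts => p ts.1); split=> //= [|s].
  by cts.
by rewrite path_zero path_one.
Qed.

Lemma homotopic_sym (x y : T) (p q : path01 R x y) :
  homotopic p q -> homotopic q p.
Proof.
move=> [H [cH H0 H1 Hs]].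
exists (fun ts => H (ts.1, clamp (1 - ival ts.2))); split => /= [|t|t|s].
- by cts.
- by rewrite ival0 subr0 -H1.
- by rewrite ival1 subrr -H0.
- exact: Hs.
Qed.

Lemma clamp_le0 (x : R) : x <= 0 -> clamp x = zero.
Proof.
move=> x0; apply: ival_inj; rewrite ival0 /ival set_valE /= max_l//.
by rewrite ge_min x0 orbT.
Qed.

Lemma clamp_ge1 (x : R) : 1 <= x -> clamp x = one.
Proof.
by move=> x1; apply: ival_inj; rewrite ival1 /ival set_valE /= min_l// max_r.
Qed.

Lemma homotopic_trans (x y : T) (p q r : path01 R x y) :
  homotopic p q -> homotopic q r -> homotopic p r.
Proof.
move=> [H [cH H0 H1 Hs]] [K [cK K0 K1 Ks]].
exists (fun ts => if ival ts.2 <= 2^-1 then H (ts.1, clamp (2 * ival ts.2))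
                  else K (ts.1, clamp (2 * ival ts.2 - 1))).
split => /= [|t|t|s].
- apply: glue_continuous => [|||[t s] /= ->].
  + by cts.
  + by cts.
  + by cts.
  + by rewrite divff// subrr clamp_ge1// clamp_le0// H1 K0.
- by rewrite ival0 invr_ge0 ler0n mulr0 clamp_le0// H0.
- by rewrite ival1 leNgt invf_lt1 ?ltr1n//= clamp_ge1 ?K1//; lra.
- by case: ifP => _; [exact: Hs|exact: Ks].
Qed.

Lemma homotopic_reparam (x y a b : T) (p : path01 R x y) (q r : path01 R a b)
    (f g : R -> R) : continuous f -> continuous g ->
  clamp (f 0) = clamp (g 0) -> clamp (f 1) = clamp (g 1) ->
  (forall t, q t = p (clamp (f (ival t)))) ->
  (forall t, r t = p (clamp (g (ival t)))) -> homotopic q r.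
Proof.
move=> cf cg fg0 fg1 qE rE.
exists (fun ts => p (clamp ((1 - ival ts.2) * ival (clamp (f (ival ts.1)))
  + ival ts.2 * ival (clamp (g (ival ts.1)))))); split => /= [|t|t|s].
- by cts.
- by rewrite ival0 subr0 mul1r mul0r addr0 ivalK -qE.
- by rewrite ival1 subrr mul1r mul0r add0r ivalK -rE.
- rewrite ival0 ival1 fg0 fg1 -!mulrDl subrK !mul1r !ivalK.
  by rewrite -[in X in X /\ _]ival0 -[in X in _ /\ X]ival1 -!rE path_zero path_one.
Qed.

End Homotopy.

Section PathOperations.
Variables (R : realType) (T : topologicalType).
Local Notation I := (unit_interval R).

Definition concat_fun (p q : I -> T) (t : I) : T :=
  if ival t <= 2^-1 then p (clamp (2 * ival t)) else q (clamp (2 * ival t - 1)).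

Section Concat.
Variables (x y z : T) (p : path01 R x y) (q : path01 R y z).

Lemma concat_continuous : continuous (concat_fun p q).
Proof.
apply: glue_continuous => [|||t ->].
- by cts.
- by cts.
- by cts.
- by rewrite divff// subrr clamp_ge1// clamp_le0// path_zero path_one.
Qed.

Lemma concat0 : concat_fun p q zero = x.
Proof. by rewrite /concat_fun ival0 invr_ge0 ler0n mulr0 clamp_le0// path_zero. Qed.

Lemma concat1 : concat_fun p q one = z.
Proof.
rewrite /concat_fun ival1 leNgt invf_lt1 ?ltr1n//= clamp_ge1 ?path_one//; lra.
Qed.

Definition concat : path01 R x z := mk_path concat_continuous concat0 concat1.

End Concat.

Section Reverse.
Variables (x y : T) (p : path01 R x y).

Definition reverse_fun (t : I) : T := p (clamp (1 - ival t)).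

Lemma reverse_continuous : continuous reverse_fun.
Proof. by rewrite /reverse_fun; cts. Qed.

Lemma reverse0 : reverse_fun zero = y.
Proof. by rewrite /reverse_fun ival0 subr0 clamp_ge1// path_one. Qed.

Lemma reverse1 : reverse_fun one = x.
Proof. by rewrite /reverse_fun ival1 subrr clamp_le0// path_zero. Qed.

Definition reverse : path01 R y x :=
  mk_path reverse_continuous reverse0 reverse1.

End Reverse.

Definition const_path (x : T) : path01 R x x := cst x.

Lemma homotopic_concat (x y z : T) (p p' : path01 R x y) (q q' : path01 R y z) :
  homotopic p p' -> homotopic q q' -> homotopic (concat p q) (concat p' q').
Proof.
move=> [H [cH H0 H1 Hs]] [K [cK K0 K1 Ks]].
exists (fun ts => if ival ts.1 <= 2^-1 then H (clamp (2 * ival ts.1), ts.2)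
                  else K (clamp (2 * ival ts.1 - 1), ts.2)).
split => /= [|t|t|s].
- apply: glue_continuous => [|||[t s] /= ->].
  + by cts.
  + by cts.
  + by cts.
  + rewrite divff// subrr clamp_ge1// clamp_le0//.
    by rewrite (Hs s).2 (Ks s).1.
- by rewrite H0 K0.
- by rewrite H1 K1.
- rewrite ival0 invr_ge0 ler0n mulr0 clamp_le0// (Hs s).1; split=> //.
  rewrite ival1 leNgt invf_lt1 ?ltr1n//= clamp_ge1 ?(Ks s).2//; lra.
Qed.

Lemma homotopic_reverse (x y : T) (p p' : path01 R x y) :
  homotopic p p' -> homotopic (reverse p) (reverse p').
Proof.
move=> [H [cH H0 H1 Hs]].
exists (fun ts => H (clamp (1 - ival ts.1), ts.2)); split => /= [|t|t|s].
- by cts.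
- by rewrite H0.
- by rewrite H1.
- by rewrite ival0 ival1 subr0 subrr clamp_ge1// clamp_le0//; case: (Hs s).
Qed.

Lemma concatA (x y z w : T) (p : path01 R x y) (q : path01 R y z)
    (r : path01 R z w) :
  homotopic (concat p (concat q r)) (concat (concat p q) r).
Proof.
apply/homotopic_sym.
pose f (t : R) := Num.min (2 * t) (Num.min (t + 2^-1 * 2^-1) (2^-1 * t + 2^-1)).
apply: (@homotopic_reparam _ _ _ _ _ _ (concat p (concat q r)) _ _ f id).
- by rewrite /f; cts.
- by cts.
- by congr clamp; rewrite /f /=; case_min; lra.
- by congr clamp; rewrite /f /=; case_min; lra.
- move=> t; have t0 := ival_ge0 t; have t1 := ival_le1 t.
  have f01 : 0 <= f (ival t) <= 1 by rewrite /f; case_min; lra.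
  rewrite /= /concat_fun /mk_path /= /concat_fun (clampE f01).
  case: (leP (ival t)) => h1.
    rewrite (@clampE _ (2 * ival t)); last by lra.
    case: (leP (2 * ival t)) => h2.
      have -> : f (ival t) = 2 * ival t by rewrite /f; case_min; lra.
      by rewrite h2.
    have -> : f (ival t) = ival t + 2^-1 * 2^-1 by rewrite /f; case_min; lra.
    rewrite ifF; last by apply/negbTE; rewrite -ltNge; lra.
    rewrite clampE; last by lra.
    by rewrite ifT; [congr (q (clamp _)); lra|lra].
  have -> : f (ival t) = 2^-1 * ival t + 2^-1 by rewrite /f; case_min; lra.
  rewrite ifF; last by apply/negbTE; rewrite -ltNge; lra.
  rewrite clampE; last by lra.
  rewrite ifF; last by apply/negbTE; rewrite -ltNge; lra.
  by congr (r (clamp _)); lra.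
- by move=> t /=; rewrite ivalK.
Qed.

Lemma const_concat (x y : T) (p : path01 R x y) :
  homotopic (concat (const_path x) p) p.
Proof.
apply: (@homotopic_reparam _ _ _ _ _ _ p _ _ (fun t => 2 * t - 1) id).
- by cts.
- by cts.
- by rewrite !clamp_le0//; lra.
- by rewrite !clamp_ge1//; lra.
- move=> t; rewrite /= /mk_path /concat_fun; case: ifP => // h.
  by rewrite -[LHS]/x clamp_le0; [rewrite path_zero|lra].
- by move=> t /=; rewrite ivalK.
Qed.

Lemma concat_const (x y : T) (p : path01 R x y) :
  homotopic (concat p (const_path y)) p.
Proof.
apply: (@homotopic_reparam _ _ _ _ _ _ p _ _ (fun t => 2 * t) id).
- by cts.
- by cts.
- by rewrite !clamp_le0//; lra.
- by rewrite !clamp_ge1//; lra.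
- move=> t; rewrite /= /mk_path /concat_fun; case: leP => // h.
  by rewrite -[LHS]/y clamp_ge1; [rewrite path_one|lra].
- by move=> t /=; rewrite ivalK.
Qed.

Lemma concat_reverse (x y : T) (p : path01 R x y) :
  homotopic (concat p (reverse p)) (const_path x).
Proof.
pose f (t : R) := Num.min (2 * t) (2 - 2 * t).
apply: (@homotopic_reparam _ _ _ _ _ _ p _ _ f (fun=> 0)).
- by rewrite /f; cts.
- by cts.
- by congr clamp; rewrite /f /=; case_min; lra.
- by congr clamp; rewrite /f /=; case_min; lra.
- move=> t; have t0 := ival_ge0 t; have t1 := ival_le1 t.
  rewrite /= /mk_path /concat_fun /reverse_fun; case: leP => h.
    by have -> : f (ival t) = 2 * ival t by rewrite /f; case_min; lra.
  have -> : f (ival t) = 2 - 2 * ival t by rewrite /f; case_min; lra.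
  by rewrite clampE; [congr (p (clamp _)); lra|lra].
- by move=> t /=; rewrite clamp_le0// path_zero.
Qed.

Lemma reverse_concat (x y : T) (p : path01 R x y) :
  homotopic (concat (reverse p) p) (const_path y).
Proof.
pose f (t : R) := 1 - Num.min (2 * t) (2 - 2 * t).
apply: (@homotopic_reparam _ _ _ _ _ _ p _ _ f (fun=> 1)).
- by rewrite /f; cts.
- by cts.
- by congr clamp; rewrite /f /=; case_min; lra.
- by congr clamp; rewrite /f /=; case_min; lra.
- move=> t; have t0 := ival_ge0 t; have t1 := ival_le1 t.
  rewrite /= /mk_path /concat_fun /reverse_fun; case: leP => h.
    rewrite clampE; last by lra.
    by congr (p (clamp _)); rewrite /f; case_min; lra.
  by congr (p (clamp _)); rewrite /f; case_min; lra.
- by move=> t /=; rewrite clamp_ge1// path_one.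
Qed.

End PathOperations.

Section FundamentalGroup.
Variables (R : realType) (T : topologicalType) (x : T).
Local Notation loop := (path01 R x x).

Definition homotopicb (p q : loop) : bool := `[< homotopic p q >].

Lemma homotopicb_refl : reflexive homotopicb.
Proof. by move=> p; apply/asboolP; exact: homotopic_refl. Qed.

Lemma homotopicb_sym : symmetric homotopicb.
Proof. by move=> p q; apply/asboolP/asboolP => /homotopic_sym. Qed.

Lemma homotopicb_trans : transitive homotopicb.
Proof.
move=> q p r /asboolP pq /asboolP qr; apply/asboolP.
exact: homotopic_trans pq qr.
Qed.

Canonical homotopic_equiv :=
  EquivRel homotopicb homotopicb_refl homotopicb_sym homotopicb_trans.

Definition pi1 : Type := {eq_quot homotopicb}.

HB.instance Definition _ := Choice.on pi1.
HB.instance Definition _ := EqQuotient.on pi1.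

Definition pi1_class (p : loop) : pi1 := \pi_pi1 p.

Lemma pi1_classP (p q : loop) : pi1_class p = pi1_class q <-> homotopic p q.
Proof. by split=> [/eqmodP/asboolP|h]; last exact/eqmodP/asboolP. Qed.

Lemma pi1_ind (P : pi1 -> Prop) : (forall p, P (pi1_class p)) -> forall a, P a.
Proof. by move=> h a; rewrite -[a]reprK; exact: h. Qed.

Lemma repr_pi1_class (p : loop) : homotopic (repr (pi1_class p)) p.
Proof. by apply/pi1_classP; rewrite /pi1_class reprK. Qed.

Definition pi1_one : pi1 := pi1_class (const_path R x).
Definition pi1_inv (a : pi1) : pi1 := pi1_class (reverse (repr a)).
Definition pi1_mul (a b : pi1) : pi1 := pi1_class (concat (repr a) (repr b)).

Lemma pi1_mulE (p q : loop) :
  pi1_mul (pi1_class p) (pi1_class q) = pi1_class (concat p q).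
Proof. by apply/pi1_classP; apply: homotopic_concat; exact: repr_pi1_class. Qed.

Lemma pi1_invE (p : loop) : pi1_inv (pi1_class p) = pi1_class (reverse p).
Proof. by apply/pi1_classP; apply: homotopic_reverse; exact: repr_pi1_class. Qed.

Lemma pi1_mulA : associative pi1_mul.
Proof.
elim/pi1_ind => p; elim/pi1_ind => q; elim/pi1_ind => r.
by rewrite !pi1_mulE; apply/pi1_classP; exact: concatA.
Qed.

Lemma pi1_mul1 : left_id pi1_one pi1_mul.
Proof.
by elim/pi1_ind => p; rewrite pi1_mulE; apply/pi1_classP; exact: const_concat.
Qed.

Lemma pi1_mul1r : right_id pi1_one pi1_mul.
Proof.
by elim/pi1_ind => p; rewrite pi1_mulE; apply/pi1_classP; exact: concat_const.
Qed.

Lemma pi1_mulV : left_inverse pi1_one pi1_inv pi1_mul.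
Proof.
elim/pi1_ind => p; rewrite pi1_invE pi1_mulE; apply/pi1_classP.
exact: reverse_concat.
Qed.

Lemma pi1_mulVr : right_inverse pi1_one pi1_inv pi1_mul.
Proof.
elim/pi1_ind => p; rewrite pi1_invE pi1_mulE; apply/pi1_classP.
exact: concat_reverse.
Qed.

HB.instance Definition _ :=
  isGroup.Build pi1 pi1_mulA pi1_mul1 pi1_mul1r pi1_mulV pi1_mulVr.

End FundamentalGroup.

Section InducedHomomorphism.
Variables (R : realType) (T U : topologicalType) (f : continuousType T U).
Variable x : T.

Definition path_image (y z : T) (p : path01 R y z) : path01 R (f y) (f z) :=
  f \o p.

Lemma homotopic_image (y z : T) (p q : path01 R y z) :
  homotopic p q -> homotopic (path_image p) (path_image q).
Proof.
move=> [H [cH H0 H1 Hs]]; exists (f \o H); split => /= [|t|t|s].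
- by apply: (continuous_comp2 _ cH); exact: cts_fun.
- by rewrite H0.
- by rewrite H1.
- by rewrite (Hs s).1 (Hs s).2.
Qed.

Definition pi1_map (a : pi1 R x) : pi1 R (f x) :=
  pi1_class (path_image (repr a)).

Lemma pi1_mapE (p : path01 R x x) :
  pi1_map (pi1_class p) = pi1_class (path_image p).
Proof. by apply/pi1_classP; apply: homotopic_image; exact: repr_pi1_class. Qed.

Lemma pi1_mapM : {morph pi1_map : a b / (a * b)%g}.
Proof.
elim/pi1_ind => p; elim/pi1_ind => q.
rewrite [LHS](congr1 pi1_map (pi1_mulE p q)) !pi1_mapE [RHS]pi1_mulE.
congr pi1_class; apply/path_eqP => t.
by rewrite /= /mk_path /concat_fun /=; case: ifP.
Qed.

Lemma pi1_map1 : pi1_map 1%g = 1%g.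
Proof.
rewrite [LHS](pi1_mapE (const_path R x)); congr pi1_class.
exact/path_eqP.
Qed.

HB.instance Definition _ :=
  isUMagmaMorphism.Build _ _ pi1_map (pi1_map1, pi1_mapM).

End InducedHomomorphism.

Arguments pi1_map R {T U} f x a.

Section SubspaceInclusion.
Variables (X : topologicalType) (A : set X) (L : set (set_type A)) (K : set X).
Hypothesis LK : forall l, L l -> K (set_val l).

Definition inclusion (l : set_type L) : set_type K :=
  exist _ (set_val (set_val l)) (mem_set (LK (set_valP l))).

Lemma inclusion_continuous : continuous inclusion.
Proof.
apply: continuous_comp_initial.
apply: (@continuous_comp2 _ _ _ (set_val : set_type L -> set_type A) set_val);
  exact: initial_continuous.
Qed.

HB.instance Definition _ := isContinuous.Build _ _ inclusion
  inclusion_continuous.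

End SubspaceInclusion.

Section Smooth.
Variable R : realType.

Definition smooth (V : normedModType R) (f : R -> V) : Prop :=
  forall (n : nat) (t : R), derivable (f^`(n)%classic) t 1.

Definition ndiff (n : nat) (f : R -> R) : Prop :=
  forall k, (k < n)%N -> forall t, derivable (f^`(k)%classic) t 1.

Lemma smoothP (f : R -> R) : smooth f <-> forall n, ndiff n f.
Proof. by split=> [h n k _|h n]; [exact: h|exact: (h n.+1)]. Qed.

Lemma ndiffS n (f : R -> R) :
  ndiff n.+1 f <-> (forall t, derivable f t 1) /\ ndiff n f^`()%classic.
Proof.
split=> [h|[h0 h]].
  by split=> [|k kn]; [exact: (h 0)|rewrite -derive1Sn; exact: h].
by case=> [|k] kn; [exact: h0|rewrite derive1Sn; exact: h].
Qed.

Lemma ndiffW n (f : R -> R) : ndiff n.+1 f -> ndiff n f.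
Proof. by move=> h k kn; apply: h; exact: ltnW. Qed.

Lemma ndiff0 (f : R -> R) : ndiff 0 f.
Proof. by []. Qed.

Lemma derive1_add (f g : R -> R) :
  (forall t, derivable f t 1) -> (forall t, derivable g t 1) ->
  (f + g)^`()%classic = f^`()%classic + g^`()%classic.
Proof.
by move=> f0 g0; apply/funext => t; rewrite derive1E (deriveD (f0 t) (g0 t))
  [RHS](_ : _ = f^`()%classic t + g^`()%classic t)// !derive1E.
Qed.

Lemma derive1_mul (f g : R -> R) :
  (forall t, derivable f t 1) -> (forall t, derivable g t 1) ->
  (f * g)^`()%classic = f * g^`()%classic + g * f^`()%classic.
Proof.
move=> f0 g0; apply/funext => t; rewrite derive1E (deriveM (f0 t) (g0 t)).
by rewrite -(derive1E g t) -(derive1E f t).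
Qed.

Lemma ndiffD n (f g : R -> R) : ndiff n f -> ndiff n g -> ndiff n (f + g).
Proof.
elim: n f g => [|n ih] f g; first by move=> _ _; exact: ndiff0.
move=> /ndiffS[f0 fn] /ndiffS[g0 gn]; apply/ndiffS.
split=> [t|]; first exact: derivableD (f0 t) (g0 t).
rewrite (derive1_add f0 g0); exact: ih fn gn.
Qed.

Lemma ndiffM n (f g : R -> R) : ndiff n f -> ndiff n g -> ndiff n (f * g).
Proof.
elim: n f g => [|n ih] f g fn gn; first exact: ndiff0.
have [[f0 f1] [g0 g1]] := ((ndiffS _ _).1 fn, (ndiffS _ _).1 gn).
apply/ndiffS; split=> [t|]; first exact: derivableM (f0 t) (g0 t).
rewrite (derive1_mul f0 g0).
exact: (ndiffD (ih _ _ (ndiffW fn) g1) (ih _ _ (ndiffW gn) f1)).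
Qed.

Lemma ndiff_comp n (f g : R -> R) : ndiff n f -> ndiff n g -> ndiff n (f \o g).
Proof.
elim: n f g => [|n ih] f g fn gn; first exact: ndiff0.
have [[f0 f1] [g0 g1]] := ((ndiffS _ _).1 fn, (ndiffS _ _).1 gn).
apply/ndiffS; split=> [t|].
  apply/derivable1_diffP/differentiable_comp.
    exact: ((derivable1_diffP _ _).1 (g0 t)).
  exact: ((derivable1_diffP _ _).1 (f0 (g t))).
have -> : (f \o g)^`()%classic = (f^`()%classic \o g) * g^`()%classic.
  by apply/funext => t; rewrite (derive1_comp (g0 t) (f0 (g t))).
exact: (ndiffM (ih _ _ f1 (ndiffW gn)) g1).
Qed.

Lemma smooth_comp (f g : R -> R) : smooth f -> smooth g -> smooth (f \o g).
Proof.
by move=> /smoothP fs /smoothP gs; apply/smoothP => n; exact: ndiff_comp.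
Qed.

Lemma smooth_id : smooth (id : R -> R).
Proof.
apply/smoothP; case=> [//|n]; apply/ndiffS; split=> [t|].
  exact: derivable_id.
have -> : (id : R -> R)^`()%classic = cst 1.
  by apply/funext => t; rewrite derive1E derive_id.
elim: n (1 : R) => [//|n ih] c; apply/ndiffS; split=> [t|].
  exact: derivable_cst.
have -> : (cst c : R -> R)^`()%classic = cst 0; last exact: ih.
by apply/funext => t; rewrite derive1E derive_cst.
Qed.

End Smooth.

Section Knots.
Variable R : realType.
Local Notation R3 := 'rV[R]_3.

(* The circle is R / Z, so that maps from the circle are 1-periodic functions.
   Compactness of the circle makes an injective immersion an embedding. *)
Record is_embedding (f : R -> R3) : Prop := IsEmbedding {
  embedding_smooth : smooth f;
  embedding_periodic : forall t, f (t + 1) = f t;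
  embedding_immersion : forall t, f^`()%classic t != 0;
  embedding_injective :
    forall s t, f s = f t -> exists k : int, s = t + k%:~R
}.

Record embedding : Type := Embedding {
  embedding_fun :> R -> R3;
  embeddingP : is_embedding embedding_fun
}.

HB.instance Definition _ := gen_eqMixin embedding.
HB.instance Definition _ := gen_choiceMixin embedding.

(* The C^oo topology: uniform convergence of all derivatives. *)
Definition jet (f : embedding) :
    prod_topology (fun _ : nat => {uniform R -> R3}) :=
  fun k => (f : R -> R3)^`(k)%classic.

HB.instance Definition _ := Topological.copy embedding (initial_topology jet).

(* The lifts to R of the orientation-preserving diffeomorphisms of R / Z: a
   bijection commuting with the unit translation is increasing. *)
Record is_circle_diffeo (phi : R -> R) : Prop := IsCircleDiffeo {
  diffeo_smooth : smooth phi;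
  diffeo_equivariant : forall t, phi (t + 1) = phi t + 1;
  diffeo_inverse :
    exists psi, [/\ smooth psi, cancel phi psi & cancel psi phi]
}.

Definition reparam (f g : embedding) : bool :=
  `[< exists2 phi, is_circle_diffeo phi & forall t, g t = f (phi t) >].

Lemma reparam_refl : reflexive reparam.
Proof.
move=> f; apply/asboolP; exists id => //; split => //; first exact: smooth_id.
by exists id; split => //; exact: smooth_id.
Qed.

Lemma reparam_symW f g : reparam f g -> reparam g f.
Proof.
move=> /asboolP[phi [phis phiD [psi [psis phiK psiK]]] gE]; apply/asboolP.
exists psi => [|t]; last by rewrite gE psiK.
split=> // [t|]; last by exists phi; split.
by apply: (can_inj phiK); rewrite psiK phiD psiK.
Qed.

Lemma reparam_sym : symmetric reparam.
Proof. by move=> f g; apply/idP/idP; exact: reparam_symW. Qed.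

Lemma reparam_trans : transitive reparam.
Proof.
move=> g f h /asboolP[phi [phis phiD [phi' [phi's phiK phi'K]]] gE].
move=> /asboolP[psi [psis psiD [psi' [psi's psiK psi'K]]] hE].
apply/asboolP; exists (phi \o psi) => [|t]; last by rewrite hE gE.
split=> [|t|]; first exact: smooth_comp.
  by rewrite /= psiD phiD.
exists (psi' \o phi'); split; first exact: smooth_comp.
  exact: can_comp.
exact: can_comp.
Qed.

Canonical reparam_equiv :=
  EquivRel reparam reparam_refl reparam_sym reparam_trans.

(* Oriented unparametrized knots are embeddings of the circle modulo
   orientation-preserving diffeomorphisms of the circle. *)
Definition knot : Type := quotient_topology {eq_quot reparam}.

HB.instance Definition _ := Topological.on knot.
HB.instance Definition _ := Quotient.on knot.

Definition knot_of (f : embedding) : knot := \pi_knot f.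

(* the standard contact form dz - y dx, at the point p, in the direction v *)
Definition contact_form (p v : R3) : R :=
  let y := p 0 1 in let dx := v 0 0 in let dz := v 0 2 in dz - y * dx.

Definition is_legendrian (f : embedding) : Prop :=
  forall t, contact_form (f t) ((f : R -> R3)^`()%classic t) = 0.

Definition legendrian : set knot :=
  [set knot_of f | f in [set f | is_legendrian f]].

Definition legendrian_knot : Type := set_type legendrian.

HB.instance Definition _ := Topological.on legendrian_knot.

End Knots.

(* Main.v *)
Require Import Defs.
From mathcomp Require Import all_boot all_order all_algebra.
From mathcomp Require Import generic_quotient.
From mathcomp Require Import all_classical all_reals all_analysis.
From mathcomp Require Import homotopy ring lra.

(** A Legendrian knot K projects to an immersed curve in the (x, y)-plane. If
    this curve has rotation number zero, its velocity has a continuous periodic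
    angle, determined up to a multiple of 2 pi; the minimum of the angle, taken
    modulo 2 pi, is a point of the circle that depends neither on the
    parametrization nor on the choice of the angle, and that varies continuously
    with K. This phase ([knot_phase], [knot_phase_continuous]) is a map from the
    space of Legendrian knots to the circle, and it detects loops: a
    null-homotopic loop of Legendrian knots has a loop of phases that lifts to
    the real line ([homotopic_angle_lift]).

    In the coordinates (x, y, w) with w = z - x y / 2, the contact form is
    dw + (x dy - y dx) / 2, so the rotations about the w-axis preserve the
    contact structure. Rotate a Legendrian unknot whose projection is a figure
    eight, which has rotation number zero, by the angles from 0 to 4 pi. Its
    phase moves by the angle of the rotation and goes twice around the circle,
    hence the loop is essential among Legendrian knots ([loop_essential]). Among
    smooth knots all linear automorphisms of the (x, y, w)-space may be used, and
    the rotation by 4 pi is a contractible loop in the rotation group: it is the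
    image of a loop of unit quaternions, which is contracted explicitly through
    nonzero quaternions ([quat_neq0], [loop_null_homotopic]).

    The kernel is thus nontrivial at one base point. Conjugating by a path
    ([conj_null], [null_conj]) gives the same at every Legendrian knot of the
    component. *)

Set Implicit Arguments.
Unset Strict Implicit.
Unset Printing Implicit Defensive.

Import Order.TTheory GRing.Theory Num.Theory numFieldNormedType.Exports.

Local Open Scope classical_set_scope.
Local Open Scope ring_scope.
Local Open Scope quotient_scope.

(** * Angles of plane vectors *)

Section Angles.
Variable R : realType.
Implicit Types (u v : R * R) (a b : R).

Definition unit_vector a : R * R := (cos a, sin a).

(** Leaving the radius unspecified makes this invariant under positive
    rescaling, hence usable for velocities before and after a
    reparametrization. *)
Definition has_angle u a : Prop :=
  exists2 r, 0 < r & u = (r * cos a, r * sin a).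

Definition dot u v : R := u.1 * v.1 + u.2 * v.2.

Definition cross u v : R := u.1 * v.2 - u.2 * v.1.

(** The signed angle from u to v when [dot u v] is positive: only then does
    the arctangent pick the right half-plane. *)
Definition turn u v : R := atan (cross u v / dot u v).

Lemma dot_self_gt0 u : u.1 != 0 \/ u.2 != 0 -> 0 < dot u u.
Proof.
have [u1 u2] : 0 <= u.1 ^+ 2 /\ 0 <= u.2 ^+ 2 by rewrite !sqr_ge0.
by rewrite /dot -!expr2 lt_def addr_ge0// andbT paddr_eq0// !sqrf_eq0 negb_and => /orP.
Qed.

Lemma dot_gt0_self u v : 0 < dot u v -> 0 < dot v v.
Proof.
move=> uv; apply: dot_self_gt0; apply/orP; rewrite -negb_and; apply/negP.
by move=> /andP[/eqP v1 /eqP v2]; move: uv; rewrite /dot v1 v2 !mulr0 addr0 ltxx.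
Qed.

Lemma dotC u v : dot u v = dot v u.
Proof. by rewrite /dot mulrC [X in _ + X]mulrC. Qed.

Definition scale a u : R * R := (a * u.1, a * u.2).

Lemma has_angle_scale u a r : 0 < r -> has_angle u a -> has_angle (scale r u) a.
Proof.
move=> r0 [s s0 ->]; exists (r * s); first by rewrite mulr_gt0.
by rewrite /scale /= !mulrA.
Qed.

Lemma dot_scale u r : dot (scale r u) (scale r u) = r * r * dot u u.
Proof. by rewrite /dot /scale /=; ring. Qed.

Lemma has_angle_uniq u a b :
  has_angle u a -> has_angle u b -> unit_vector a = unit_vector b.
Proof.
move=> [r r0 ->] [s s0] [ec es]; have ca := cos2Dsin2 a; have cb := cos2Dsin2 b.
have rs : r = s.
  apply/eqP; rewrite -(@eqrXn2 _ 2) ?ltW//; apply/eqP.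
  rewrite -[LHS]mulr1 -ca -[RHS]mulr1 -cb !mulrDr -!exprMn.
  by rewrite ec es.
move: ec es; rewrite -rs => /(mulfI (lt0r_neq0 r0)) ec /(mulfI (lt0r_neq0 r0)) es.
by rewrite /unit_vector ec es.
Qed.

(** As complex numbers, the product of v and the conjugate of u is dot + i
    cross; if its real part is positive, its argument is the arctangent of
    cross / dot. *)
Lemma has_angle_turn u v a :
  has_angle u a -> 0 < dot u v -> has_angle v (a + turn u v).
Proof.
move=> [r r0 ->]; rewrite /turn; set d := dot _ _; set c := cross _ _ => d0.
set b := atan _; have cb : 0 < cos b.
  by rewrite cos_gt0_pihalf// atan_gtNpi2 atan_ltpi2.
have sb : sin b = c / d * cos b.
  have := atanK (c / d); rewrite -/b /tan => <-; rewrite divfK//; exact: lt0r_neq0.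
have ca := cos2Dsin2 a.
exists (d / (r * cos b)); first by rewrite divr_gt0// mulr_gt0.
rewrite [LHS]surjective_pairing cosD sinD sb; congr pair.
  have -> : cos a * cos b - sin a * (c / d * cos b) =
    (cos a - sin a * (c / d)) * cos b by ring.
  have -> : d / (r * cos b) * ((cos a - sin a * (c / d)) * cos b) =
    (d * cos a - sin a * c) / r by field; rewrite !gt_eqF.
  apply: (mulIf (lt0r_neq0 r0)); rewrite divfK ?gt_eqF//.
  rewrite /c /d /dot /cross /= -[LHS]mulr1 -ca; ring.
have -> : sin a * cos b + cos a * (c / d * cos b) =
    (sin a + cos a * (c / d)) * cos b by ring.
have -> : d / (r * cos b) * ((sin a + cos a * (c / d)) * cos b) =
  (d * sin a + cos a * c) / r by field; rewrite !gt_eqF.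
apply: (mulIf (lt0r_neq0 r0)); rewrite divfK ?gt_eqF//.
rewrite /c /d /dot /cross /= -[LHS]mulr1 -ca; ring.
Qed.

(** Half-angle formula: 1 - cos a = 2 sin^2 (a / 2), and the sine is positive
    on (0, pi). *)
Lemma small_angle_eq0 a : `|a| < pi -> cos a = 1 -> a = 0.
Proof.
move=> ap ca; have : sin (a / 2) = 0.
  apply/eqP; rewrite -sqrf_eq0 sin2cos2.
  have := cos_mulr2n (a / 2); have -> : a / 2 *+ 2 = a by field.
  rewrite ca => h.
  by apply/eqP; lra.
wlog a0 : a ap ca / 0 <= a => [wl|].
  have [a0|a0] := leP 0 a; first exact: wl.
  move=> s0; apply: oppr_inj; rewrite oppr0; apply: wl; rewrite ?normrN ?cosN//.
    by rewrite oppr_ge0 ltW.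
  by rewrite mulNr sinN s0 oppr0.
rewrite ger0_norm// in ap; move: a0; rewrite le_eqVlt => /orP[/eqP//|a0].
have : 0 < sin (a / 2) by rewrite sin_gt0_pi//; lra.
by move=> + s0; rewrite s0 ltxx.
Qed.

(** The angles of a given unit vector form a discrete set. If theta took a
    second value, it would by the intermediate value theorem also take a value
    at a distance from [theta a] between 0 and 1, which is the angle of
    another vector. *)
Lemma continuous_angle_const (theta : R -> R) a :
  continuous theta -> (forall t, unit_vector (theta t) = unit_vector (theta a)) ->
  forall t, theta t = theta a.
Proof.
move=> ct cst t.
have key (x : R) : Num.min (theta a) (theta t) <= x <= Num.max (theta a) (theta t) ->
    unit_vector x = unit_vector (theta a).
  move=> xl; pose lo := Num.min a t; pose hi := Num.max a t.
  have lohi : lo <= hi by rewrite /lo /hi; case: (leP a t) => // /ltW.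
  have [|c _ <-] := @IVT _ theta lo hi x lohi (continuous_subspaceT ct); last exact: cst.
  by move: xl; rewrite /lo /hi; case: (leP a t) => _ //; rewrite minC maxC.
apply/eqP/negPn/negP => ne.
pose d := theta t - theta a.
have d0 : d != 0 by rewrite subr_eq0.
pose e : R := Num.min `|d| 1.
have e0 : 0 < e by rewrite lt_min normr_gt0 d0 /=.
have pi2 : 2 <= pi :> R := pi_ge2 R.
have e1 : e <= 1 by rewrite ge_min lexx orbT.
have ed : e <= `|d| by rewrite ge_min lexx.
pose x := theta a + Num.sg d * e.
have xl : Num.min (theta a) (theta t) <= x <= Num.max (theta a) (theta t).
  have tE : theta t = theta a + d by rewrite /d addrC subrK.
  rewrite /x tE; case: (ltgtP d 0) d0 ed => // ds _ ed.
    by rewrite ltr0_sg//; rewrite ltr0_norm// in ed; case: (leP (theta a) (theta a + d)); lra.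
  by rewrite gtr0_sg//; rewrite gtr0_norm// in ed; case: (leP (theta a) (theta a + d)); lra.
have [ec es] := key _ xl.
have : Num.sg d * e = 0.
  apply: small_angle_eq0; first by rewrite normrM normr_sg d0 mul1r gtr0_norm//;
    apply: (le_lt_trans e1); apply: lt_le_trans pi2; rewrite ltr1n.
  have -> : Num.sg d * e = x - theta a by rewrite /x; ring.
  by rewrite cosB ec es -!expr2 cos2Dsin2.
by apply/eqP; rewrite mulf_neq0 ?sgr_eq0// gt_eqF.
Qed.

End Angles.

(** * Continuous choices of angle *)

Section AngleLifts.
Variable R : realType.
Local Notation I := (unit_interval R).

(** E relates the points where the angle has to agree. It stands for a circle,
    presented as the real line modulo a unit translation or as the unit
    interval with its ends glued, without forming the quotient. *)
Definition angle_lift (X : topologicalType) (E : X -> X -> Prop)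
    (u : X -> R * R) (theta : X -> R) : Prop :=
  [/\ continuous theta, forall x y, E x y -> theta x = theta y &
      forall x, has_angle (u x) (theta x)].

Section Turning.
Variables (X : topologicalType) (E : X -> X -> Prop).
Implicit Types (u v : X -> R * R).

Lemma continuous_dot u v :
  continuous u -> continuous v -> continuous (fun x => dot (u x) (v x)).
Proof. by move=> cu cv; rewrite /dot; cts. Qed.

Lemma continuous_turn u v : continuous u -> continuous v ->
  (forall x, 0 < dot (u x) (v x)) -> continuous (fun x => turn (u x) (v x)).
Proof.
move=> cu cv uv.
have cV : continuous (fun x => (dot (u x) (v x))^-1).
  by move=> x; apply: cvgV; [exact: lt0r_neq0|exact: continuous_dot].
have ca : continuous (@atan R) by move=> x; exact: continuous_atan.
apply: (continuous_comp2 ca); apply: continuous_mul cV.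
by rewrite /cross; cts.
Qed.

(** Rotating a lift by the angle from u to v is possible when that angle is
    always less than pi / 2: this is the elementary step from which all lifts
    below are built. *)
Lemma angle_lift_turn u v theta : continuous u -> continuous v ->
  (forall x y, E x y -> u x = u y) -> (forall x y, E x y -> v x = v y) ->
  (forall x, 0 < dot (u x) (v x)) -> angle_lift E u theta ->
  angle_lift E v (fun x => theta x + turn (u x) (v x)).
Proof.
move=> cu cv Eu Ev uv [ct Et ut]; split=> [|x y xy|x].
- have := continuous_turn cu cv uv => ct'.
  by apply: continuous_add.
- by rewrite (Et _ _ xy) (Eu _ _ xy) (Ev _ _ xy).
- exact: has_angle_turn.
Qed.

End Turning.

(** The real line is connected. *)
Lemma locally_constant (P : R -> Prop) :
  (forall s, \forall s' \near s, P s <-> P s') -> forall a b, P a -> P b.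
Proof.
move=> lc a b Pa.
have oP : open [set s | P s].
  by rewrite openE => s /= Ps; apply: filterS (lc s) => s' [+ _]; apply.
have oN : open (~` [set s | P s]).
  rewrite openE => s /= nPs; apply: filterS (lc s) => s' [_ h] /h.
  exact: nPs.
have cT : connected [set: R] by apply/connected_intervalP => ? ? _ _ ? _.
have PT : [set s | P s] = setT.
  apply: cT; first by exists a.
    by exists [set s | P s] => //; rewrite setTI.
  by exists [set s | P s]; rewrite ?setTI// -openC.
by have : setT b by []; rewrite -PT.
Qed.

Lemma unit_interval_compact : compact [set: I].
Proof.
have -> : [set: I] = @clamp R @` `[0, 1].
  apply/seteqP; split=> // t _; exists (ival t); last exact: ivalK.
  by rewrite /= in_itv /= ival_ge0 ival_le1.
apply: continuous_compact; last exact: segment_compact.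
exact/continuous_subspaceT/clamp_continuous.
Qed.

Definition ends (s t : I) : Prop := s = zero /\ t = one.

(** At two close times of the homotopy the loops point, everywhere along the
    compact interval, into a common open half-plane, so a lift of one can be
    turned into a lift of the other. Liftability is thus a locally constant
    function of the time. *)
Lemma homotopic_angle_lift (G : I * I -> R * R) : continuous G ->
  (forall p, 0 < dot (G p) (G p)) -> (forall s, G (zero, s) = G (one, s)) ->
  (exists theta, angle_lift ends (fun t => G (t, zero)) theta) ->
  exists theta, angle_lift ends (fun t => G (t, one)) theta.
Proof.
move=> cG G0 Ge.
pose g (s : R) (t : I) := G (t, clamp s).
pose P s := exists theta, angle_lift ends (g s) theta.
have -> : zero = clamp 0 :> I by rewrite clamp_le0.
have -> : one = clamp 1 :> I by rewrite clamp_ge1.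
apply: (@locally_constant P) => s.
have gE s' x y : ends x y -> g s' x = g s' y by move=> [-> ->]; exact: Ge.
have cg s' : continuous (g s') by rewrite /g; cts.
(* What remains is uniformity in t, which comes from compactness. *)
suff : \forall s' \near s, [set: I] `<=` (fun t => 0 < dot (g s t) (g s' t)).
  apply: filterS => s' ss'0; have ss' t := ss'0 t Logic.I; split=> -[theta h].
    exists (fun t => theta t + turn (g s t) (g s' t)).
    exact: (angle_lift_turn (cg s) (cg s') (gE s) (gE s') ss' h).
  exists (fun t => theta t + turn (g s' t) (g s t)).
  apply: (angle_lift_turn (cg s') (cg s) (gE s') (gE s) _ h) => t.
  by rewrite dotC; exact: ss'.
have /compact_near_coveringP nc := unit_interval_compact.
apply: (nc R (nbhs s) (fun s' t => 0 < dot (g s t) (g s' t))) => t _ /=.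
have c : continuous (fun p : I * R => dot (g s p.1) (g p.2 p.1) : R).
  by apply: continuous_dot; rewrite /g; cts.
have := c (t, s) [set x | 0 < x]; apply.
by apply: open_nbhs_nbhs; split; [exact: open_gt|exact: G0].
Qed.

(** A lift would differ from k t by a constant, and so would not take the same
    value at both ends. *)
Lemma turning_no_angle_lift (theta : I -> R) (a k : R) : k != 0 ->
  ~ angle_lift ends (fun t => unit_vector (a + k * ival t)) theta.
Proof.
move=> k0 [ct te tl].
pose f (x : R) := theta (clamp x) - k * ival (clamp x).
have cf : continuous f by rewrite /f; cts.
have fE x : unit_vector (f x) = unit_vector a.
  have [r r0 e] := tl (clamp x).
  have : has_angle (unit_vector (a + k * ival (clamp x))) (a + k * ival (clamp x)).
    by exists 1; rewrite ?ltr01// !mul1r.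
  move=> /(has_angle_uniq (tl _)) [ec es].
  rewrite /unit_vector /f cosB sinB ec es; congr pair.
    by rewrite -cosB addrK.
  by rewrite -sinB addrK.
have : f 1 = f 0 by apply: continuous_angle_const => // t; rewrite !fE.
rewrite /f clamp_ge1// clamp_le0// ival0 ival1 (te _ _ (conj erefl erefl)).
by move=> /addrI/oppr_inj/eqP; rewrite mulr1 mulr0 (negbTE k0).
Qed.

End AngleLifts.

(** * Neighbourhoods in the smooth topology *)

Section EmbeddingTopology.
Variable R : realType.
Local Notation R3 := 'rV[R]_3.

Definition nderiv (f : embedding R) (k : nat) : R -> R3 :=
  (f : R -> R3)^`(k)%classic.

(** Each single derivative is a continuous function of the embedding, for the
    uniform norm. *)
Lemma near_jet (f : embedding R) k (e : R) : 0 < e ->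
  \forall g \near f, forall t, `|nderiv f k t - nderiv g k t| < e.
Proof.
move=> e0.
have cj : continuous (fun g : embedding R => @jet R g k : {uniform R -> R3}).
  have pj : continuous (fun h : prod_topology (fun _ : nat => {uniform R -> R3}) =>
      h k : {uniform R -> R3}).
    exact: (@proj_continuous nat (fun=> {uniform R -> R3}) k).
  have ij : continuous (@jet R) := @initial_continuous _ _ (@jet R).
  exact: (continuous_comp2 pj ij).
have := cj f [set h : {uniform R -> R3} | forall t, `|nderiv f k t - h t| < e].
apply; apply/uniform_nbhs.
exists [set xy : R3 * R3 | `|xy.1 - xy.2| < e]; split.
  have := @entourage_ball R R3 (PosNum e0).
  by rewrite -ball_normE.
by move=> h /= + t; apply.
Qed.

(** The smooth topology is the coarsest one for which every derivative is
    continuous for the uniform norm. *)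
Lemma embedding_continuous (X : topologicalType) (F : X -> embedding R) :
  (forall k x (e : R), 0 < e ->
    \forall y \near x, forall t, `|nderiv (F x) k t - nderiv (F y) k t| < e) ->
  continuous F.
Proof.
move=> h; apply: continuous_comp_initial => x; apply/cvg_sup => k.
move: x; apply: (@continuous_comp_initial _ X {uniform R -> R3}) => x.
move=> U /uniform_nbhs[E [entE EU]].
have [e /= e0 eE] : exists2 e : R, 0 < e & forall y z : R3, `|y - z| < e -> E (y, z).
  move: entE; rewrite -entourage_from_ballE => -[e /= e0 eE].
  by exists e => // y z yz; apply: eE; rewrite /= -ball_normE.
apply: filterS (h k x e e0) => y yx; apply: EU => t _; exact/eE/yx.
Qed.

End EmbeddingTopology.

(** * The velocity of the projection to the (x, y)-plane *)

Section PeriodicFunctions.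
Variable R : realType.

Lemma periodic_int (T : Type) (u : R -> T) : (forall t, u (t + 1) = u t) ->
  forall (k : int) t, u (t + k%:~R) = u t.
Proof.
move=> up; have upn n t : u (t + n%:R) = u t.
  by elim: n => [|n ih]; rewrite ?addr0// -natr1 addrA up ih.
case=> n t; first exact: upn.
by rewrite -(upn n.+1) NegzE mulrNz subrK.
Qed.

Lemma periodic_minimum (u : R -> R) : continuous u ->
  (forall t, u (t + 1) = u t) -> exists m, forall t, u m <= u t.
Proof.
move=> cu up; have [m _ um] := EVT_min ler01 (continuous_subspaceT cu).
exists m => t; rewrite -(periodic_int up (- Num.floor t) t); apply: um.
have /andP[] := floor_itv t; rewrite intrD in_itv /= mulrNz.
by move=> h1 h2; lra.
Qed.

End PeriodicFunctions.

Section Phase.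
Variable R : realType.
Local Notation R3 := 'rV[R]_3.
Implicit Types (f g : embedding R).

Lemma nderiv_continuous f k : continuous (nderiv f k).
Proof.
move=> t; apply: differentiable_continuous; apply/derivable1_diffP.
exact: embedding_smooth (embeddingP f) k t.
Qed.

Lemma derive1_periodic (V : normedModType R) (h : R -> V) :
  (forall t, h (t + 1) = h t) -> forall t, h^`()%classic (t + 1) = h^`()%classic t.
Proof.
move=> hp t; rewrite !derive1E /derive.
suff -> : (fun x : R => x^-1 *: ((h \o shift (t + 1)) (x *: 1) - h (t + 1))) =
    (fun x : R => x^-1 *: ((h \o shift t) (x *: 1) - h t)) by [].
by apply/funext => x; rewrite /= addrA !hp.
Qed.

Lemma nderiv_periodic f k t : nderiv f k (t + 1) = nderiv f k t.
Proof.
elim: k t => [|k ih] t; first exact: embedding_periodic (embeddingP f) t.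
by rewrite /nderiv /= derive1_periodic.
Qed.

(** The velocity of the Lagrangian projection of f, that is, of its projection
    along the z-axis. *)
Definition plane_velocity f (t : R) : R * R :=
  (nderiv f 1 t 0 0, nderiv f 1 t 0 1).

Definition plane_immersed f : Prop :=
  forall t, 0 < dot (plane_velocity f t) (plane_velocity f t).

Lemma nderiv_coord_continuous f k i : continuous (fun t => nderiv f k t 0 i).
Proof.
apply: (@continuous_comp2 _ _ _ (nderiv f k) (fun v : R3 => v 0 i)).
  exact: coord_continuous.
exact: nderiv_continuous.
Qed.

Lemma plane_velocity_continuous f : continuous (plane_velocity f).
Proof. by apply: continuous_pair; exact: nderiv_coord_continuous. Qed.

Lemma plane_velocity_periodic f t : plane_velocity f (t + 1) = plane_velocity f t.
Proof. by rewrite /plane_velocity !nderiv_periodic. Qed.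

Lemma coord_le_norm (v w : R3) i : `|v 0 i - w 0 i| <= `|v - w|.
Proof.
rewrite [leRHS]mx_normrE.
have := le_bigmax 0 (fun ij : 'I_1 * 'I_3 => `|(v - w) ij.1 ij.2|) (0, i).
by rewrite /= !mxE.
Qed.

(** The velocity of f is bounded away from 0 by periodicity, so that any
    uniformly small change of the velocity turns it by a uniformly small
    angle. *)
Lemma near_turn f (e : R) : plane_immersed f -> 0 < e ->
  \forall g \near f, forall t,
    0 < dot (plane_velocity f t) (plane_velocity g t) /\
    `|turn (plane_velocity f t) (plane_velocity g t)| < e.
Proof.
move=> fi e0; pose u := plane_velocity f.
pose n t : R := `|(u t).1| + `|(u t).2|.
have cn : continuous n.
  have cnorm : continuous (fun x : R => `|x|) by exact: norm_continuous.
  apply: continuous_add; apply: (continuous_comp2 cnorm); exact: nderiv_coord_continuous.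
have [m nm] : exists m, forall t, n m <= n t.
  apply: periodic_minimum => [|t]; first exact: cn.
  by rewrite /n /u plane_velocity_periodic.
have c0 : 0 < n m.
  rewrite lt_def addr_ge0// andbT; apply/negP; rewrite paddr_eq0// !normr_eq0.
  by move=> /andP[/eqP h1 /eqP h2]; have := fi m; rewrite /dot -/(u m) h1 h2 !mulr0 addr0 ltxx.
have [d d0 dP] : exists2 d : R, 0 < d & forall y, `|y| < d -> `|atan y| < e.
  have := @continuous_atan R 0 (ball 0 e).
  move=> /(_ _)[|d /= d0 dP]; first by rewrite atan0; exact: nbhsx_ballx.
  by exists d => // y yd; have := dP y; rewrite -!ball_normE /= !sub0r !normrN; apply.
(* If the coordinates of the velocity change by less than k, then the dot
   product is at least n (n / 2 - k) and the cross product at most n k, where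
   n is at least [n m]; the two bounds on k make the first positive and the
   quotient smaller than d. *)
pose k : R := Num.min (n m / 4) (d * n m / 8).
have k0 : 0 < k by rewrite lt_min !divr_gt0// mulr_gt0.
have k1 : k <= n m / 4 by rewrite ge_min lexx.
have k2 : k <= d * n m / 8 by rewrite ge_min lexx orbT.
apply: filterS (near_jet f 1 k0) => g fg t; have := nm t; rewrite /n /u.
have : `|(plane_velocity g t).1 - (plane_velocity f t).1| < k.
  by rewrite distrC; apply: le_lt_trans (fg t); rewrite coord_le_norm.
have : `|(plane_velocity g t).2 - (plane_velocity f t).2| < k.
  by rewrite distrC; apply: le_lt_trans (fg t); rewrite coord_le_norm.
move: (plane_velocity g t) (plane_velocity f t) => [v1 v2] [u1 u2] /=; set c := n m in k1 k2 c0 *.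
set a := v1 - u1; set b := v2 - u2 => bk ak cu.
have e1 : v1 = u1 + a by rewrite addrC subrK.
have e2 : v2 = u2 + b by rewrite addrC subrK.
pose p := `|u1|; pose q := `|u2|.
have p0 : 0 <= p := normr_ge0 _; have q0 : 0 <= q := normr_ge0 _.
have bnd (x y : R) : `|y| < k -> - (`|x| * k) <= x * y <= `|x| * k.
  by move=> yk; rewrite -ler_norml normrM ler_wpM2l// ltW.
have h1 := bnd u1 a ak; have h2 := bnd u2 b bk.
have h3 := bnd u1 b bk; have h4 := bnd u2 a ak.
have p2 : p * p = u1 * u1 by rewrite -normrM ger0_norm// -expr2 sqr_ge0.
have q2 : q * q = u2 * u2 by rewrite -normrM ger0_norm// -expr2 sqr_ge0.
have sq : (p + q) * (p + q) <= 2 * (u1 * u1 + u2 * u2).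
  by rewrite -p2 -q2; have := sqr_ge0 (p - q); lra.
have cpq : c * (p + q) <= (p + q) * (p + q) by rewrite ler_wpM2r// addr_ge0.
have kpq1 : k * (p + q) <= c / 4 * (p + q) by rewrite ler_wpM2r// addr_ge0.
have kpq2 : k * (p + q) <= d * c / 8 * (p + q) by rewrite ler_wpM2r// addr_ge0.
rewrite -/p -/q in h1 h2 h3 h4 cu.
have pq0 : 0 < p + q by apply: lt_le_trans cu.
have cpq0 : 0 < c * (p + q) by rewrite mulr_gt0.
have dE : dot (u1, u2) (v1, v2) >= c / 4 * (p + q).
  by rewrite /dot /= e1 e2; lra.
have d1 : 0 < dot (u1, u2) (v1, v2) by apply: lt_le_trans dE; lra.
split=> //; rewrite /turn; apply: dP; rewrite normrM normfV (gtr0_norm d1) ltr_pdivrMr//.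
apply: (@lt_le_trans _ _ (d * (c / 4 * (p + q)))); last by rewrite ler_pM2l.
apply: (@le_lt_trans _ _ (d * c / 8 * (p + q))).
  apply: le_trans kpq2; rewrite ler_norml /cross /= e1 e2; lra.
have : 0 < d * (c * (p + q)) by rewrite mulr_gt0.
lra.
Qed.

End Phase.

(** * The phase of a knot *)

Section PhaseMap.
Variable R : realType.
Local Notation R3 := 'rV[R]_3.
Implicit Types (f g : embedding R) (theta : R -> R).

Definition unit_shift (s t : R) : Prop := t = s + 1.

Definition direction_lift f theta : Prop :=
  angle_lift unit_shift (plane_velocity f) theta.

(** The smallest angle of the velocity, as opposed to its angle at some chosen
    time, does not see the parametrization. Two periodic lifts differ by a
    multiple of 2 pi, hence the unit vector at the smallest angle does not see
    the lift. *)
Definition phase_value f (v : R * R) : Prop :=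
  exists theta m, [/\ direction_lift f theta, forall t, theta m <= theta t &
                   v = unit_vector (theta m)].

(** When the velocity has nonzero rotation number, and therefore no periodic
    angle, the phase is set to (1, 0). Among plane-immersed curves, having a
    periodic angle is an open and closed condition, so that this arbitrary
    constant does not spoil continuity. *)
Definition phase f : R * R := xget (1, 0) (phase_value f).

Lemma unit_vectorD (a b c : R) : unit_vector a = unit_vector b ->
  unit_vector (a + c) = unit_vector (b + c).
Proof. by move=> [ec es]; rewrite /unit_vector !cosD !sinD ec es. Qed.

Lemma phase_value_uniq f v w : phase_value f v -> phase_value f w -> v = w.
Proof.
move=> [th [m [[ct _ tl] tm ->]]] [th' [m' [[ct' _ tl'] tm' ->]]].
have same t : unit_vector (th t) = unit_vector (th' t).
  exact: has_angle_uniq (tl t) (tl' t).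
have cst t : th t - th' t = th m - th' m.
  apply: (@continuous_angle_const _ (fun t => th t - th' t)) => [|s].
    by cts.
  by rewrite (unit_vectorD (- th' s) (same s)) (unit_vectorD (- th' m) (same m)) !subrr.
have -> : th m = th m'.
  apply/le_anti; rewrite tm /=; have := tm' m; have := cst m'; lra.
exact: same.
Qed.

Lemma phaseE f theta m : direction_lift f theta ->
  (forall t, theta m <= theta t) -> phase f = unit_vector (theta m).
Proof.
move=> ft tm; have fv : phase_value f (unit_vector (theta m)) by exists theta, m.
by apply: xget_unique => // w fw; exact: phase_value_uniq fw fv.
Qed.

Lemma direction_lift_minimum f theta : direction_lift f theta ->
  exists m, forall t, theta m <= theta t.
Proof.
by move=> [ct tp _]; apply: periodic_minimum => [//|t]; rewrite -(tp t).
Qed.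

Lemma phase_noE f : ~ (exists theta, direction_lift f theta) -> phase f = (1, 0).
Proof. by move=> h; apply: xgetPN => v [th [m [ft _ _]]]; apply: h; exists th. Qed.

Lemma unit_vector_continuous : continuous (@unit_vector R).
Proof.
by apply: continuous_pair; [exact: continuous_cos|exact: continuous_sin].
Qed.

Lemma direction_lift_turn f g theta :
  (forall t, 0 < dot (plane_velocity f t) (plane_velocity g t)) ->
  direction_lift f theta ->
  direction_lift g (fun t => theta t + turn (plane_velocity f t) (plane_velocity g t)).
Proof.
have shift_velocity h x y : unit_shift x y -> plane_velocity h x = plane_velocity h y.
  by move=> ->; rewrite plane_velocity_periodic.
move=> fg.
exact: (angle_lift_turn (@plane_velocity_continuous R f) (@plane_velocity_continuous R g)
  (shift_velocity f) (shift_velocity g) fg).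
Qed.

(** Each minimum is at most the value of the same function at the other
    minimizer. *)
Lemma minimum_close theta (d : R -> R) (e m n : R) : (forall t, `|d t| < e) ->
  (forall t, theta m <= theta t) -> (forall t, theta n + d n <= theta t + d t) ->
  `|theta m - (theta n + d n)| < e.
Proof.
move=> de tm tn; have := de m; have := de n; have := tm n; have := tn m.
by rewrite !ltr_norml; lra.
Qed.

(** For g close to f, turning the angles of f gives angles of g that are
    uniformly close to them, and then the two minima are close. The same
    turning from g to f shows that g has no periodic angle if f has none. *)
Lemma phase_continuous f (U : set (R * R)) : plane_immersed f ->
  nbhs (phase f) U -> \forall g \near f, U (phase g).
Proof.
move=> fi fU; have [[theta ft]|nf] := pselect (exists theta, direction_lift f theta).
  have [m tm] := direction_lift_minimum ft.
  move: fU; rewrite (phaseE ft tm) => /(@unit_vector_continuous (theta m)) /=.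
  move=> /nbhs_ballP[e /= e0 eU].
  apply: filterS (near_turn fi e0) => g fg /=.
  have gt := direction_lift_turn (fun t => (fg t).1) ft.
  have [n gn] := direction_lift_minimum gt.
  rewrite (phaseE gt gn); apply: eU; rewrite -ball_normE.
  exact: minimum_close (fun t => (fg t).2) tm gn.
move: fU; rewrite (phase_noE nf) => /nbhs_singleton U1.
apply: filterS (near_turn fi (@ltr01 R)) => g fg /=.
suff ng : ~ (exists theta, direction_lift g theta) by rewrite (phase_noE ng).
move=> [theta gt]; apply: nf.
exists (fun t => theta t + turn (plane_velocity g t) (plane_velocity f t)).
by apply: direction_lift_turn gt => t; rewrite dotC; exact: (fg t).1.
Qed.

Lemma plane_immersed_open : open [set f : embedding R | plane_immersed f].
Proof.
rewrite openE => f /= fi; apply: filterS (near_turn fi (@ltr01 R)) => g fg t.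
exact: dot_gt0_self (fg t).1.
Qed.

(** The derivative does not vanish, because phi has a differentiable inverse;
    it is equal to 1 somewhere, by the mean value theorem on a period; and it
    is continuous. *)
Lemma diffeo_derive_gt0 (phi : R -> R) : is_circle_diffeo phi ->
  forall t, 0 < phi^`()%classic t.
Proof.
move=> [sphi phiD [psi [spsi phiK psiK]]].
have dphi t : derivable phi t 1 := sphi 0%N t.
have nz t : phi^`()%classic t != 0.
  have := derive1_comp (dphi t) (spsi 0%N (phi t)).
  have -> : psi \o phi = id by apply/funext.
  rewrite derive1E derive_id => /esym/eqP; apply: contraL => /eqP ->.
  by rewrite mulr0 eq_sym oner_eq0.
have cphi' : continuous phi^`()%classic.
  move=> t; apply: differentiable_continuous; apply/derivable1_diffP; exact: (sphi 1%N t).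
have cphi : continuous phi.
  by move=> t; apply: differentiable_continuous; apply/derivable1_diffP.
have [c _ e] : exists2 c, c \in `]0, 1[%R & phi 1 - phi 0 = phi^`()%classic c * (1 - 0).
  apply: MVT => //; last exact: continuous_subspaceT.
  by move=> x _; rewrite derive1E; exact: derivableP.
have c1 : phi^`()%classic c = 1.
  by move: e; rewrite -[in phi 1](add0r 1) phiD subr0 mulr1; lra.
move=> t; rewrite ltNge; apply/negP => t0.
have cs a b : {within `[a, b], continuous phi^`()%classic}.
  exact: continuous_subspaceT.
suff [x /eqP] : exists x, phi^`()%classic x = 0 by rewrite (negbTE (nz x)).
have [ct|tc] := leP c t.
  have [|x _ ex] := @IVT _ _ _ _ 0 ct (cs _ _); last by exists x.
  by rewrite c1 minC min_l ?max_l; lra.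
have [|x _ ex] := @IVT _ _ _ _ 0 (ltW tc) (cs _ _); last by exists x.
by rewrite c1 min_l ?max_r; lra.
Qed.

Lemma derive1_coord (h : R -> R3) t i : derivable h t 1 ->
  h^`()%classic t 0 i = (fun s => h s 0 i)^`()%classic t.
Proof. by move=> dh; rewrite !derive1E derive_mx// mxE. Qed.

Lemma reparam_nderiv f g phi : is_circle_diffeo phi ->
  (forall t, g t = f (phi t)) ->
  forall t i, nderiv g 1 t 0 i = phi^`()%classic t * nderiv f 1 (phi t) 0 i.
Proof.
move=> phid gE t i; rewrite /nderiv /=.
have df s : derivable f s 1 by have /(_ 0%N s) := embedding_smooth (embeddingP f).
have dg s : derivable g s 1 by have /(_ 0%N s) := embedding_smooth (embeddingP g).
rewrite !derive1_coord//.
have -> : (fun s => g s 0 i) = (fun s => f s 0 i) \o phi.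
  by apply/funext => s; rewrite gE.
rewrite derive1_comp; first by rewrite mulrC.
  by have /(_ 0%N t) := diffeo_smooth phid.
by have /derivable_mxP := df (phi t).
Qed.

Lemma reparam_velocity f g phi : is_circle_diffeo phi ->
  (forall t, g t = f (phi t)) -> forall t,
  plane_velocity g t = scale (phi^`()%classic t) (plane_velocity f (phi t)).
Proof.
move=> phid gE t; rewrite /plane_velocity /scale.
by apply: congr2; exact: reparam_nderiv.
Qed.

(** Composing with a circle diffeomorphism rescales the velocity by a positive
    factor and permutes the values of the angle. *)
Lemma phase_value_reparam f g v : reparam f g -> phase_value f v -> phase_value g v.
Proof.
move=> /asboolP[phi phid gE] [theta [m [[ct tp tl] tm ->]]].
have [psi [_ phiK psiK]] := diffeo_inverse phid.
have cphi : continuous phi.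
  move=> t; apply: differentiable_continuous; apply/derivable1_diffP.
  by have /(_ 0%N t) := diffeo_smooth phid.
exists (theta \o phi), (psi m); rewrite /= psiK; split => //.
split=> [|x y ->|t].
- exact: continuous_comp2.
- by rewrite /= (diffeo_equivariant phid); exact: tp.
- rewrite (reparam_velocity phid gE).
  by apply: has_angle_scale; [exact: diffeo_derive_gt0|exact: tl].
Qed.

Lemma phase_reparam f g : reparam f g -> phase f = phase g.
Proof.
move=> fg; congr xget; apply/seteqP; split=> v; apply: phase_value_reparam => //.
by rewrite reparam_sym.
Qed.

Lemma plane_immersed_reparam f g : reparam f g -> plane_immersed f -> plane_immersed g.
Proof.
move=> /asboolP[phi phid gE] fi t; rewrite (reparam_velocity phid gE) dot_scale.
by apply: mulr_gt0; [rewrite mulr_gt0// diffeo_derive_gt0|exact: fi].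
Qed.

Definition knot_phase (k : knot R) : R * R := phase (repr k).

Lemma knot_ofP f g : knot_of f = knot_of g <-> reparam f g.
Proof. by split=> [/eqmodP|h]; last exact/eqmodP. Qed.

Lemma knot_phaseE f : knot_phase (knot_of f) = phase f.
Proof. by apply/phase_reparam/knot_ofP; rewrite /knot_of reprK. Qed.

(** The contact planes are transverse to the z-axis: if dx = dy = 0, then dz =
    y dx = 0 too. *)
Lemma legendrian_plane_immersed f : is_legendrian f -> plane_immersed f.
Proof.
move=> fl t; apply: dot_self_gt0; apply/orP; rewrite -negb_and; apply/negP.
rewrite /plane_velocity /nderiv /= => /andP[/eqP x0 /eqP y0].
have := fl t; rewrite /contact_form /= x0 mulr0 subr0 => z0.
have /negP := embedding_immersion (embeddingP f) t; apply; apply/eqP/rowP => i.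
rewrite mxE; case: i => -[|[|[|//]]] Hi.
- by rewrite -[RHS]x0; congr (_ _ _); exact/val_inj.
- by rewrite -[RHS]y0; congr (_ _ _); exact/val_inj.
- by rewrite -[RHS]z0; congr (_ _ _); exact/val_inj.
Qed.

Lemma knot_open (B : set (knot R)) : open ((@knot_of R) @^-1` B) -> open B.
Proof. exact. Qed.

Lemma knot_of_continuous : continuous (@knot_of R).
Proof. exact: pi_continuous. Qed.

(** Legendrian knots carry the subspace topology of a quotient, which need not
    a priori be a quotient of the space of Legendrian embeddings. This is why
    the phase was defined for every embedding: the plane-immersed embeddings
    are an open union of reparametrization classes, which gives an open set of
    knots on which the phase is continuous. *)
Lemma knot_phase_continuous : continuous (fun k : legendrian_knot R => knot_phase (set_val k)).
Proof.
move=> k; have [f fl fk] : exists2 f, is_legendrian f & knot_of f = set_val k := set_valP k.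
have fi := legendrian_plane_immersed fl.
suff cv : {for (set_val k), continuous knot_phase}.
  have ck : continuous (set_val : legendrian_knot R -> knot R).
    exact: initial_continuous.
  by apply: (@continuous_comp _ _ _ (set_val : legendrian_knot R -> knot R) knot_phase k);
    [exact: ck|exact: cv].
rewrite -fk => U; rewrite knot_phaseE /= => fU.
pose O := [set g | plane_immersed g /\ nbhs (phase g) U].
pose B := [set l : knot R | O (repr l)].
have BE : (@knot_of R) @^-1` B = O.
  apply/seteqP; split=> g; rewrite /B /O /= => -[gi gU].
    have rg : reparam (repr (knot_of g)) g by apply/knot_ofP; rewrite /knot_of reprK.
    by rewrite -(phase_reparam rg); split=> //; exact: plane_immersed_reparam gi.
  have rg : reparam g (repr (knot_of g)) by apply/knot_ofP; rewrite /knot_of reprK.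
  by rewrite -(phase_reparam rg); split=> //; exact: plane_immersed_reparam gi.
have oO : open O.
  rewrite openE => g [gi gU]; apply: filterI.
    by have := plane_immersed_open; rewrite openE => /(_ g gi).
  exact: (phase_continuous gi (nbhs_interior gU)).
have oB : open B by apply: knot_open; rewrite BE.
apply: (@filterS _ _ _ B); first by move=> l [_ /nbhs_singleton].
apply: open_nbhs_nbhs; split; first exact: oB.
have : ((@knot_of R) @^-1` B) f by rewrite BE; exact: (conj fi fU).
exact.
Qed.

End PhaseMap.

(** * Functions depending continuously on a parameter with all derivatives *)

Section SmoothFamilies.
Variables (R : realType) (X : topologicalType).
Implicit Types (G H : X -> R -> R).

(** Boundedness in the variable t is what makes products of such functions
    continuous in the parameter x. *)
Definition tame G : Prop :=
  (forall x, exists M, forall t, `|G x t| <= M) /\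
  (forall x (e : R), 0 < e -> \forall y \near x, forall t, `|G x t - G y t| < e).

(** G x depends continuously on x in the C^n norm. The recursion on the first
    derivative lets closure under products be proved from the Leibniz rule for
    one derivative. *)
Fixpoint Cn_family (n : nat) G : Prop :=
  tame G /\
  if n is m.+1 then
    (forall x t, derivable (G x) t 1) /\ Cn_family m (fun x => (G x)^`()%classic)
  else True.

Lemma Cn_family_tame n G : Cn_family n G -> tame G.
Proof. by case: n => [|n] []. Qed.

Lemma Cn_familyW n G : Cn_family n.+1 G -> Cn_family n G.
Proof.
elim: n G => [|n ih] G [tG [dG fG]]; first by split.
by split=> //; split=> //; exact: ih.
Qed.

Lemma Cn_family_derive1n n G : Cn_family n G -> tame (fun x => (G x)^`(n)%classic).
Proof.
elim: n G => [|n ih] G [tG]; first by [].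
move=> [_ /ih]; congr tame; apply/funext => x; by rewrite derive1Sn.
Qed.

Lemma Cn_family_smooth G x : (forall n, Cn_family n G) -> smooth (G x).
Proof.
move=> fG; apply/smoothP => n.
elim: n G {fG}(fG n) => [//|n ih] G [_ [dG fG]].
by apply/ndiffS; split; [exact: dG|exact: (ih _ fG)].
Qed.

Lemma tame_add G H : tame G -> tame H -> tame (fun x => G x + H x).
Proof.
move=> [bG cG] [bH cH]; split=> [x|x e e0].
  have [[M GM] [N HN]] := (bG x, bH x); exists (M + N) => t.
  by apply: (le_trans (ler_normD _ _)); exact: lerD.
have e2 : 0 < e / 2 by rewrite divr_gt0.
near=> y => t.
have -> : (G x + H x) t - (G y + H y) t = (G x t - G y t) + (H x t - H y t).
  by rewrite -[(G x + H x) t]/(G x t + H x t) -[(G y + H y) t]/(G y t + H y t); ring.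
apply: le_lt_trans (ler_normD _ _) _; rewrite (splitr e); apply: ltrD.
  by move: t; near: y; exact: cG.
by move: t; near: y; exact: cH.
Unshelve. all: by end_near. Qed.

Lemma tame_mul G H : tame G -> tame H -> tame (fun x => G x * H x).
Proof.
move=> [bG cG] [bH cH]; split=> [x|x e e0].
  have [[M GM] [N HN]] := (bG x, bH x); exists (M * N) => t.
  by rewrite normrM; exact: ler_pM.
have [[M GM] [N HN]] := (bG x, bH x).
have M0 : 0 <= M := le_trans (normr_ge0 _) (GM 0).
have N0 : 0 <= N := le_trans (normr_ge0 _) (HN 0).
(* By the decomposition of the difference below, products change by at most
   (M + N + d) d when the factors change by at most d. *)
pose d := Num.min 1 (e / (M + N + 1 + 1)).
have d0 : 0 < d by rewrite lt_min ltr01 divr_gt0//; lra.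
have d1 : d <= 1 by rewrite ge_min lexx.
have d2 : d * (M + N + 1 + 1) <= e.
  by rewrite -ler_pdivlMr ?ge_min ?lexx ?orbT//; lra.
near=> y.
have gy : forall t, `|G x t - G y t| < d by near: y; exact: cG.
have hy : forall t, `|H x t - H y t| < d by near: y; exact: cH.
move=> t; move: (GM t) (HN t) (gy t) (hy t).
rewrite -[(G x * H x) t]/(G x t * H x t) -[(G y * H y) t]/(G y t * H y t).
move: (G x t) (G y t) (H x t) (H y t) => g g' h h' gM hN gg hh.
have -> : g * h - g' * h' = g * (h - h') + (g - g') * h - (g - g') * (h - h') by ring.
apply: le_lt_trans (ler_normB _ _) _.
apply: (@le_lt_trans _ _ (M * d + d * N + 1 * d)).
  apply: lerD; first (apply: le_trans (ler_normD _ _) _; apply: lerD).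
  - by rewrite normrM ler_pM// ltW.
  - by rewrite normrM ler_pM// ltW.
  - by rewrite normrM ler_pM// ltW// (lt_le_trans gg d1).
lra.
Unshelve. all: by end_near. Qed.

Lemma tame_cst (a : X -> R) : continuous a -> tame (fun x => cst (a x)).
Proof.
move=> ca; split=> [x|x e e0]; first by exists `|a x|.
have /cvgrPdist_lt/(_ e e0) : a y @[y --> x] --> a x := ca x.
by apply: filterS => y ay t.
Qed.

Lemma Cn_family_add n G H : Cn_family n G -> Cn_family n H -> Cn_family n (fun x => G x + H x).
Proof.
elim: n G H => [|n ih] G H [tG fG] [tH fH]; split=> //; try exact: tame_add.
have [[dG {}fG] [dH {}fH]] := (fG, fH); split=> [x t|].
  exact: derivableD (dG x t) (dH x t).
have -> : (fun x => (G x + H x)^`()%classic) =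
    (fun x => (G x)^`()%classic + (H x)^`()%classic).
  by apply/funext => x; exact: derive1_add.
exact: ih.
Qed.

Lemma Cn_family_mul n G H : Cn_family n G -> Cn_family n H -> Cn_family n (fun x => G x * H x).
Proof.
elim: n G H => [|n ih] G H fG fH.
  by split=> //; exact: tame_mul (Cn_family_tame fG) (Cn_family_tame fH).
have [[tG [dG dfG]] [tH [dH dfH]]] := (fG, fH).
split; first exact: tame_mul.
split=> [x t|]; first exact: derivableM (dG x t) (dH x t).
have -> : (fun x => (G x * H x)^`()%classic) =
    (fun x => G x * (H x)^`()%classic + H x * (G x)^`()%classic).
  by apply/funext => x; exact: derive1_mul.
by apply: Cn_family_add; apply: ih => //; exact: Cn_familyW.
Qed.

Lemma Cn_family_cst n (a : X -> R) : continuous a -> Cn_family n (fun x => cst (a x)).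
Proof.
elim: n a => [|n ih] a ca; first by split=> //; exact: tame_cst.
split; first exact: tame_cst.
split=> [x t|]; first exact: derivable_cst.
have -> : (fun x => (cst (a x) : R -> R)^`()%classic) = (fun x => cst (cst 0 x)).
  by apply/funext => x; apply/funext => t; rewrite derive1E derive_cst.
by apply: ih; exact: continuous_cst0.
Qed.

Definition wave_cos (t : R) : R := cos (2 * pi * t).

Definition wave_sin (t : R) : R := sin (2 * pi * t).

Lemma is_derive_wave_cos (t : R) : is_derive t (1 : R) wave_cos (- (2 * pi) * wave_sin t).
Proof.
rewrite /wave_cos; apply: is_derive_eq.
by rewrite /GRing.scale /= /wave_sin; ring.
Qed.

Lemma is_derive_wave_sin (t : R) : is_derive t (1 : R) wave_sin (2 * pi * wave_cos t).
Proof.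
rewrite /wave_sin; apply: is_derive_eq.
by rewrite /GRing.scale /= /wave_cos; ring.
Qed.

Lemma derive1_wave_cos : wave_cos^`()%classic = cst (- (2 * pi)) * wave_sin.
Proof.
by apply/funext => t; rewrite derive1E; have [_ ->] := is_derive_wave_cos t.
Qed.

Lemma derive1_wave_sin : wave_sin^`()%classic = cst (2 * pi) * wave_cos.
Proof.
by apply/funext => t; rewrite derive1E; have [_ ->] := is_derive_wave_sin t.
Qed.

Lemma Cn_family_wave n : Cn_family n (fun=> wave_cos) /\ Cn_family n (fun=> wave_sin).
Proof.
have tc : tame (fun=> wave_cos).
  split=> [x|x e e0]; last by apply: nearW => y t; rewrite subrr normr0.
  by exists 1 => t; rewrite ler_norml cos_geN1 cos_le1.
have ts : tame (fun=> wave_sin).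
  split=> [x|x e e0]; last by apply: nearW => y t; rewrite subrr normr0.
  by exists 1 => t; rewrite ler_norml sin_geN1 sin_le1.
elim: n => [|n [ihc ihs]]; first by [].
have cc (a : R) : continuous (fun _ : X => a) by exact: continuous_cst0.
split; split=> //; split.
- by move=> x t; have [] := is_derive_wave_cos t.
- by rewrite derive1_wave_cos; apply: Cn_family_mul => //; exact: Cn_family_cst.
- by move=> x t; have [] := is_derive_wave_sin t.
- by rewrite derive1_wave_sin; apply: Cn_family_mul => //; exact: Cn_family_cst.
Qed.

End SmoothFamilies.

Section CoordinateFamilies.
Variable R : realType.
Local Notation R3 := 'rV[R]_3.

Definition row3 (a b c : R) : R3 := \row_(i < 3) [:: a; b; c]`_i.

Lemma row3_0 a b c : row3 a b c 0 0 = a. Proof. by rewrite mxE. Qed.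
Lemma row3_1 a b c : row3 a b c 0 1 = b. Proof. by rewrite mxE. Qed.
Lemma row3_2 a b c : row3 a b c 0 2 = c. Proof. by rewrite mxE. Qed.

Lemma derive1n_coord (h : R -> R3) : (forall i, smooth (fun t => h t 0 i)) ->
  forall k, (forall t, derivable (h^`(k)%classic) t 1) /\
    forall t i, h^`(k)%classic t 0 i = (fun s => h s 0 i)^`(k)%classic t.
Proof.
move=> sh; elim=> [|k [ihd ih]].
  split=> // t; apply/derivable_mxP => i j; rewrite ord1; exact: (sh j 0%N t).
have ih' t i : h^`(k.+1)%classic t 0 i = (fun s => h s 0 i)^`(k.+1)%classic t.
  rewrite /= derive1_coord; last exact: ihd.
  by congr (_^`()%classic t); apply/funext => s; exact: ih.
split; last exact: ih'.
move=> t; apply/derivable_mxP => i j; rewrite ord1.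
have -> : (fun x => h^`(k.+1)%classic x 0 j) = (fun s => h s 0 j)^`(k.+1)%classic.
  by apply/funext => s; exact: ih'.
exact: (sh j k.+1 t).
Qed.

Lemma norm_lt_coord (v w : R3) (e : R) : 0 < e ->
  (forall i, `|v 0 i - w 0 i| < e) -> `|v - w| < e.
Proof.
move=> e0 h; rewrite [ltLHS]mx_normrE; apply: bigmax_lt => //= -[i j] _ /=.
by rewrite ord1 !mxE.
Qed.

Lemma embedding_family_continuous (X : topologicalType) (F : X -> embedding R) :
  (forall n i, Cn_family n (fun x t => F x t 0 i)) -> continuous F.
Proof.
move=> fF; apply: embedding_continuous => k x e e0.
have sF y i : smooth (fun t => F y t 0 i).
  exact: (@Cn_family_smooth R X (fun x t => F x t 0 i) y (fF^~ i)).
have c i : \forall y \near x, forall t, `|nderiv (F x) k t 0 i - nderiv (F y) k t 0 i| < e.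
  have [_ /(_ x e e0)] := Cn_family_derive1n (fF k i).
  apply: filterS => y h t; have := h t; rewrite /nderiv.
  have [[_ ex] [_ ey]] := (derive1n_coord (sF x) k, derive1n_coord (sF y) k).
  by rewrite ex ey.
have cc : \forall y \near x, forall i t,
    `|nderiv (F x) k t 0 i - nderiv (F y) k t 0 i| < e by apply: filter_forall; exact: c.
by apply: filterS cc => y h t; apply: norm_lt_coord.
Qed.

End CoordinateFamilies.

(** * A Legendrian figure eight and its rotations *)

Section Curve.
Variable R : realType.
Local Notation R3 := 'rV[R]_3.
Local Notation C := (@wave_cos R).
Local Notation S := (@wave_sin R).

(** The curve is given in the coordinates (x, y, w) with w = z - x y / 2,
    where the contact form dz - y dx becomes dw + (x dy - y dx) / 2 and is
    therefore invariant under the rotations about the w-axis. With T = 2 pi t,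
    the projection is the figure eight (sin 2T, sin T), and w = cos T - cos^3
    T / 3 is obtained by integrating the contact condition. *)
Definition curve_x (t : R) : R := 2 * (S t * C t).
Definition curve_y (t : R) : R := S t.
Definition curve_w (t : R) : R := C t + (- 3^-1) * (C t * C t * C t).

Lemma wave_sqr t : C t * C t + S t * S t = 1.
Proof. by rewrite -!expr2 cos2Dsin2. Qed.

(** After subtracting the nearest integer, the angle has absolute value at
    most pi. *)
Lemma wave_cosP t : C t = 1 -> exists k : int, t = k%:~R.
Proof.
move=> c1; pose k := Num.floor (t + 2^-1); exists k.
have /andP[k1 k2] := floor_itv (t + 2^-1); rewrite -/k intrD in k1 k2.
pose r := t - k%:~R; have r1 : - 2^-1 <= r by rewrite /r; lra.
have r2 : r < 2^-1 by rewrite /r; lra.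
have pi0 : 0 < pi :> R := pi_gt0 R.
have perC : forall t, C (t + 1) = C t.
  by move=> x; rewrite /wave_cos mulrDr mulr1 mulr_natl cosD2pi.
have cr : cos (2 * pi * r) = 1.
  transitivity (C t); last exact: c1.
  by rewrite -(periodic_int perC (- k) t) mulrNz.
apply/eqP; rewrite -subr_eq0 -/r; apply/eqP.
have [r3|r3] := eqVneq r (- 2^-1).
  move: cr; rewrite r3 mulrN cosN (_ : 2 * pi / 2 = pi); last by field.
  by rewrite cospi; lra.
have : 2 * pi * r = 0.
  apply: small_angle_eq0 => //; rewrite ltr_norml; apply/andP; split.
    have : - 2^-1 < r by rewrite lt_def r3.
    by rewrite -(ltr_pM2l pi0); lra.
  by move: r2; rewrite -(ltr_pM2l pi0); lra.
move=> /eqP; rewrite !mulf_eq0 pnatr_eq0 (gt_eqF pi0) /=.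
by move/eqP.
Qed.

(** The figure eight crosses itself only at y = 0, where cos T is 1 or -1 and
    the two values of w are 2/3 and -2/3. *)
Lemma curve_injective s t : curve_x s = curve_x t -> curve_y s = curve_y t ->
  curve_w s = curve_w t -> exists k : int, s = t + k%:~R.
Proof.
rewrite /curve_x /curve_y /curve_w => ex ey ew.
have [hs ht] := (wave_sqr s, wave_sqr t).
have ec : C s = C t.
  have [s0|s0] := eqVneq (S t) 0.
    move: hs ht; rewrite ey s0 mulr0 !addr0 => hs ht.
    have := ew; rewrite hs ht !mul1r; lra.
  have two : (2 : R) != 0 by rewrite pnatr_eq0.
  by rewrite ey in ex; exact: (mulfI s0 (mulfI two ex)).
have [|k stk] := @wave_cosP (s - t).
  rewrite /wave_cos mulrBr cosB -/(wave_cos s) -/(wave_cos t).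
  by rewrite -/(wave_sin s) -/(wave_sin t) ec ey wave_sqr.
by exists k; rewrite -stk addrC subrK.
Qed.

(** The coordinates of q v q', for the quaternions q = a + d i + b k and
    v = x i + y j + w k and the conjugate q' of q: a rotation of (x, y, w),
    scaled by |q|^2. *)
Definition rotate_x (a b d x y w : R) : R :=
  (a * a + d * d - b * b) * x + (- (2 * a * b)) * y + (2 * b * d) * w.
Definition rotate_y (a b d x y w : R) : R :=
  (2 * a * b) * x + (a * a - d * d - b * b) * y + (- (2 * a * d)) * w.
Definition rotate_w (a b d x y w : R) : R :=
  (2 * b * d) * x + (2 * a * d) * y + (a * a - d * d + b * b) * w.

(** With q' the conjugate of q, q' (q v q') q = |q|^4 v. *)
Lemma rotate_inverse (a b d x y w : R) :
  let X := rotate_x a b d x y w in let Y := rotate_y a b d x y w in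
  let W := rotate_w a b d x y w in let N := a * a + b * b + d * d in
  [/\ rotate_x a (- b) (- d) X Y W = N * N * x,
      rotate_y a (- b) (- d) X Y W = N * N * y &
      rotate_w a (- b) (- d) X Y W = N * N * w].
Proof. by rewrite /rotate_x /rotate_y /rotate_w; split; ring. Qed.

Lemma rotate_injective (a b d x y w x' y' w' : R) :
  a * a + b * b + d * d != 0 ->
  rotate_x a b d x y w = rotate_x a b d x' y' w' ->
  rotate_y a b d x y w = rotate_y a b d x' y' w' ->
  rotate_w a b d x y w = rotate_w a b d x' y' w' ->
  [/\ x = x', y = y' & w = w'].
Proof.
move=> N0 eX eY eW; have NN := mulf_neq0 N0 N0.
have /= [hx hy hw] := rotate_inverse a b d x y w.
have /= [hx' hy' hw'] := rotate_inverse a b d x' y' w'.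
by split; apply: (mulfI NN); [rewrite -hx -hx'|rewrite -hy -hy'|rewrite -hw -hw'];
  rewrite eX eY eW.
Qed.

Definition spun_x (a b d t : R) : R :=
  rotate_x a b d (curve_x t) (curve_y t) (curve_w t).
Definition spun_y (a b d t : R) : R :=
  rotate_y a b d (curve_x t) (curve_y t) (curve_w t).
Definition spun_w (a b d t : R) : R :=
  rotate_w a b d (curve_x t) (curve_y t) (curve_w t).

(** The rotated curve, brought back from (x, y, w) to (x, y, z). *)
Definition spun (a b d t : R) : R3 :=
  row3 (spun_x a b d t) (spun_y a b d t)
       (spun_w a b d t + 2^-1 * (spun_x a b d t * spun_y a b d t)).

Lemma Cn_family_spun (X : topologicalType) (a b d : X -> R) :
  continuous a -> continuous b -> continuous d ->
  forall n i, Cn_family n (fun x t => spun (a x) (b x) (d x) t 0 i).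
Proof.
move=> ca cb cd n i.
have [fc fs] := Cn_family_wave R X n.
have cst_f (k : X -> R) : continuous k -> Cn_family n (fun x => cst (k x)).
  exact: Cn_family_cst.
have fx : Cn_family n (fun _ : X => curve_x).
  have c2 : continuous (fun _ : X => 2 : R) by exact: continuous_cst0.
  exact: (Cn_family_mul (cst_f _ c2) (Cn_family_mul fs fc)).
have fy : Cn_family n (fun _ : X => curve_y) by [].
have fw : Cn_family n (fun _ : X => curve_w).
  have c3 : continuous (fun _ : X => - 3^-1 : R) by exact: continuous_cst0.
  exact: (Cn_family_add fc (Cn_family_mul (cst_f _ c3) (Cn_family_mul (Cn_family_mul fc fc) fc))).
have frot (k l m : X -> R) : continuous k -> continuous l -> continuous m ->
    Cn_family n (fun x t => k x * curve_x t + l x * curve_y t + m x * curve_w t).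
  move=> ck cl cm.
  exact: (Cn_family_add
    (Cn_family_add (Cn_family_mul (cst_f k ck) fx) (Cn_family_mul (cst_f l cl) fy))
    (Cn_family_mul (cst_f m cm) fw)).
have fX : Cn_family n (fun x => spun_x (a x) (b x) (d x)) by apply: frot; cts.
have fY : Cn_family n (fun x => spun_y (a x) (b x) (d x)) by apply: frot; cts.
have fW : Cn_family n (fun x => spun_w (a x) (b x) (d x)) by apply: frot; cts.
have c2 : continuous (fun _ : X => 2^-1 : R) by exact: continuous_cst0.
case: i => -[|[|[|//]]] Hi.
- suff -> : (fun x t => spun (a x) (b x) (d x) t 0 (Ordinal Hi)) =
    (fun x => spun_x (a x) (b x) (d x)) by [].
  by apply/funext => x; apply/funext => t; rewrite mxE.
- suff -> : (fun x t => spun (a x) (b x) (d x) t 0 (Ordinal Hi)) =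
    (fun x => spun_y (a x) (b x) (d x)) by [].
  by apply/funext => x; apply/funext => t; rewrite mxE.
- suff -> : (fun x t => spun (a x) (b x) (d x) t 0 (Ordinal Hi)) =
    (fun x => spun_w (a x) (b x) (d x) + cst 2^-1 *
       (spun_x (a x) (b x) (d x) * spun_y (a x) (b x) (d x))).
    exact: (Cn_family_add fW (Cn_family_mul (cst_f _ c2) (Cn_family_mul fX fY))).
  by apply/funext => x; apply/funext => t; rewrite mxE.
Qed.

Lemma wave_periodic t : C (t + 1) = C t /\ S (t + 1) = S t.
Proof.
by rewrite /wave_cos /wave_sin mulrDr mulr1 mulr_natl cosD2pi sinD2pi.
Qed.

Lemma is_derive_curve_x (t : R) :
  is_derive t (1 : R) curve_x (2 * pi * (4 * (C t * C t) - 2)).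
Proof.
have dc := is_derive_wave_cos t; have ds := is_derive_wave_sin t.
rewrite /curve_x; apply: is_derive_eq.
have := wave_sqr t; rewrite /GRing.scale /=.
set c := C t; set s := S t => h.
have -> : 4 * (c * c) - 2 = 2 * (c * c - s * s) by lra.
ring.
Qed.

Lemma is_derive_curve_w (t : R) :
  is_derive t (1 : R) curve_w (2 * pi * (- (S t * S t * S t))).
Proof.
have dc := is_derive_wave_cos t.
rewrite /curve_w; apply: is_derive_eq.
have := wave_sqr t; rewrite /GRing.scale /=.
set c := C t; set s := S t => h.
have cc : c * c = 1 - s * s by lra.
transitivity (2 * pi * (- s * (1 - c * c))); first by field.
by rewrite cc; ring.
Qed.

End Curve.

(** * The rotated curves as knots, and their phases *)

Section SpunKnots.
Variable R : realType.
Local Notation C := (@wave_cos R).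
Local Notation S := (@wave_sin R).
Implicit Types a b d t : R.

Lemma is_derive_linear3 (k l m t dx dy dw : R) (x y w : R -> R) :
  is_derive t (1 : R) x dx -> is_derive t (1 : R) y dy -> is_derive t (1 : R) w dw ->
  is_derive t (1 : R) (fun s => k * x s + l * y s + m * w s) (k * dx + l * dy + m * dw).
Proof.
move=> hx hy hw; apply: is_derive_eq.
by rewrite /GRing.scale /=; ring.
Qed.

Definition curve_dx t : R := 2 * pi * (4 * (C t * C t) - 2).
Definition curve_dy t : R := 2 * pi * C t.
Definition curve_dw t : R := 2 * pi * (- (S t * S t * S t)).

Definition spun_dx a b d t := rotate_x a b d (curve_dx t) (curve_dy t) (curve_dw t).
Definition spun_dy a b d t := rotate_y a b d (curve_dx t) (curve_dy t) (curve_dw t).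
Definition spun_dw a b d t := rotate_w a b d (curve_dx t) (curve_dy t) (curve_dw t).

Lemma is_derive_spun a b d t :
  [/\ is_derive t (1 : R) (spun_x a b d) (spun_dx a b d t),
      is_derive t (1 : R) (spun_y a b d) (spun_dy a b d t) &
      is_derive t (1 : R) (spun_w a b d) (spun_dw a b d t)].
Proof.
have hx := is_derive_curve_x t; have hy : is_derive t (1 : R) (@curve_y R) (curve_dy t).
  exact: is_derive_wave_sin.
have hw := is_derive_curve_w t.
by split; exact: is_derive_linear3.
Qed.

Lemma smooth_spun a b d : smooth (spun a b d).
Proof.
move=> k; suff sm i : smooth (fun t => spun a b d t 0 i).
  exact: (derive1n_coord sm k).1.
apply: (@Cn_family_smooth R R (fun _ t => spun a b d t 0 i) 0) => n.
by apply: (@Cn_family_spun R R (fun=> a) (fun=> b) (fun=> d)); exact: continuous_cst0.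
Qed.

Lemma spun_derive1 a b d t :
  let h := (spun a b d)^`()%classic t in
  [/\ h 0 0 = spun_dx a b d t, h 0 1 = spun_dy a b d t &
      h 0 2 = spun_dw a b d t +
        2^-1 * (spun_dx a b d t * spun_y a b d t + spun_x a b d t * spun_dy a b d t)].
Proof.
have [hx hy hw] := is_derive_spun a b d t.
have dh : derivable (spun a b d) t 1 := @smooth_spun a b d 0%N t.
rewrite /= !derive1_coord//; split.
- have -> : (fun s => spun a b d s 0 0) = spun_x a b d.
    by apply/funext => s; rewrite row3_0.
  by rewrite derive1E; have [_ ->] := hx.
- have -> : (fun s => spun a b d s 0 1) = spun_y a b d.
    by apply/funext => s; rewrite row3_1.
  by rewrite derive1E; have [_ ->] := hy.
- have -> : (fun s => spun a b d s 0 2) =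
      (fun s => spun_w a b d s + 2^-1 * (spun_x a b d s * spun_y a b d s)).
    by apply/funext => s; rewrite row3_2.
  rewrite derive1E; apply: derive_val; apply: is_derive_eq.
  by rewrite /GRing.scale /=; ring.
Qed.

Lemma rotate0 a b d :
  [/\ rotate_x a b d 0 0 0 = 0, rotate_y a b d 0 0 0 = 0 & rotate_w a b d 0 0 0 = 0].
Proof. by rewrite /rotate_x /rotate_y /rotate_w !mulr0 !addr0. Qed.

(** The map from (x, y, w) to the new coordinates is a diffeomorphism of
    space, being the composition of an invertible linear map and a shear. *)
Lemma is_embedding_spun a b d :
  a * a + b * b + d * d != 0 -> is_embedding (spun a b d).
Proof.
move=> abd; split.
- exact: smooth_spun.
- move=> t; have [ec es] := wave_periodic t.
  by rewrite /spun /spun_x /spun_y /spun_w /curve_x /curve_y /curve_w ec es.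
- move=> t; apply/eqP => h0; have /= [] := spun_derive1 a b d t.
  rewrite h0 !mxE => /esym ex /esym ey; rewrite ex ey mul0r mulr0 addr0 mulr0 addr0.
  move=> /esym ew; have [z1 z2 z3] := rotate0 a b d.
  rewrite -[RHS]z1 in ex; rewrite -[RHS]z2 in ey; rewrite -[RHS]z3 in ew.
  have [hx hy _] := rotate_injective abd ex ey ew.
  have p0 : 2 * pi != 0 :> R by rewrite mulf_neq0// gt_eqF// pi_gt0.
  move/eqP: hy; rewrite /curve_dy mulf_eq0 (negbTE p0) /= => /eqP c0.
  move/eqP: hx; rewrite /curve_dx mulf_eq0 (negbTE p0) /= c0 !mulr0 sub0r oppr_eq0.
  by rewrite pnatr_eq0.
- move=> s t st.
  have eX : spun_x a b d s = spun_x a b d t.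
    by rewrite -[LHS](row3_0 _ (spun_y a b d s)
      (spun_w a b d s + 2^-1 * (spun_x a b d s * spun_y a b d s))) -/(spun a b d s) st row3_0.
  have eY : spun_y a b d s = spun_y a b d t.
    by rewrite -[LHS](row3_1 (spun_x a b d s) _
      (spun_w a b d s + 2^-1 * (spun_x a b d s * spun_y a b d s))) -/(spun a b d s) st row3_1.
  have eW : spun_w a b d s = spun_w a b d t.
    apply: (addIr (2^-1 * (spun_x a b d s * spun_y a b d s))).
    rewrite -[LHS](row3_2 (spun_x a b d s) (spun_y a b d s)) -/(spun a b d s) st row3_2.
    by rewrite eX eY.
  have [hx hy hw] := rotate_injective abd eX eY eW.
  exact: curve_injective.
Qed.

(** For d = 0 the rotation fixes the w-axis and so preserves the contact form
    in the coordinates (x, y, w). *)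
Lemma is_legendrian_spun a b (ab : is_embedding (spun a b 0)) :
  a * a + b * b = 1 -> is_legendrian (Embedding ab).
Proof.
move=> ab1 t; rewrite /contact_form /=.
have /= [-> _ ->] := spun_derive1 a b 0 t; rewrite row3_1.
rewrite /spun_dw /spun_dx /spun_dy /spun_x /spun_y /rotate_x /rotate_y /rotate_w.
rewrite /curve_dx /curve_dy /curve_dw /curve_x /curve_y /curve_w.
have := wave_sqr t; move: (wave_cos t) (wave_sin t) => c s h.
have cc : c * c = 1 - s * s by lra.
(* The rotation multiplies dw by a^2 + b^2 and x dy - y dx by its square. *)
transitivity (2 * pi * ((a * a + b * b) * (- (s * s * s)) +
    2^-1 * ((a * a + b * b) * (a * a + b * b)) * (2 * (s * (c * c)) - s * (4 * (c * c) - 2)))).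
  by field.
by rewrite ab1 cc; field.
Qed.

Lemma has_angle_rotate (u : R * R) (p q : R) : has_angle u q ->
  has_angle (cos p * u.1 - sin p * u.2, sin p * u.1 + cos p * u.2) (q + p).
Proof.
move=> [r r0 ->]; exists r => //=; rewrite cosD sinD.
by congr pair; ring.
Qed.

(** With c = cos T, the velocity is 2 pi (4 c^2 - 2, c), which never points in
    the direction of (1, 0). The vector (-1, 4c) makes an acute angle with
    both (-1, 0) and the velocity, hence a periodic angle is obtained from the
    constant pi by two turns. *)
Lemma curve_angle_lift : exists theta,
  angle_lift (@unit_shift R) (fun t => (curve_dx t, curve_dy t)) theta.
Proof.
have pi0 : 0 < pi :> R := pi_gt0 R.
have cC : continuous C.
  by move=> t; apply: differentiable_continuous; apply/derivable1_diffP;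
    have [] := is_derive_wave_cos t.
have nC (x y : R) : unit_shift x y -> C x = C y.
  by move=> ->; have [-> _] := wave_periodic x.
pose u0 (t : R) : R * R := (-1, 0).
pose u1 (t : R) : R * R := (-1, 4 * C t).
have h0 : angle_lift (@unit_shift R) u0 (fun=> pi).
  split=> // [|t]; first exact: continuous_cst0.
  by exists 1 => //; rewrite /u0 cospi sinpi !mul1r.
have c0 : continuous u0 by rewrite /u0; move=> t; exact: cvg_cst.
have c1 : continuous u1 by rewrite /u1; cts.
have h1 : angle_lift (@unit_shift R) u1 (fun t => pi + turn (u0 t) (u1 t)).
  apply: (angle_lift_turn c0 c1 _ _ _ h0) => [//|x y xy|t].
    by rewrite /u1 (nC x y xy).
  by rewrite /dot /u0 /u1 /=; lra.
exists (fun t => pi + turn (u0 t) (u1 t) + turn (u1 t) (curve_dx t, curve_dy t)).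
apply: (angle_lift_turn c1 _ _ _ _ h1) => [|x y xy|x y xy|t].
- by rewrite /curve_dx /curve_dy; cts.
- by rewrite /u1 (nC x y xy).
- by rewrite /curve_dx /curve_dy (nC x y xy).
- rewrite /dot /u1 /curve_dx /curve_dy /=; move: (C t) => c.
  have -> : -1 * (2 * pi * (4 * (c * c) - 2)) + 4 * c * (2 * pi * c) = 4 * pi :> R by ring.
  by rewrite mulr_gt0.
Qed.

(** The quaternion cos p + k sin p rotates the (x, y)-plane, hence all the
    angles of the velocity, by 2 p. *)
Lemma spun_phase : exists m : R, forall (p : R)
  (h : is_embedding (spun (cos p) (sin p) 0)), phase (Embedding h) = unit_vector (m + 2 * p).
Proof.
have [theta [ct tp tl]] := curve_angle_lift.
have [m tm] : exists m, forall t, theta m <= theta t.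
  by apply: periodic_minimum => [//|t]; rewrite -(tp t).
exists (theta m) => p h.
have hl : direction_lift (Embedding h) (fun t => theta t + 2 * p).
  split=> [|x y xy|t]; first by cts.
    by rewrite (tp _ _ xy).
  have /= [e1 e2 _] := spun_derive1 (cos p) (sin p) 0 t.
  have -> : plane_velocity (Embedding h) t =
      (spun_dx (cos p) (sin p) 0 t, spun_dy (cos p) (sin p) 0 t).
    by rewrite -e1 -e2.
  have := has_angle_rotate (2 * p) (tl t).
  congr (has_angle _ _); rewrite /spun_dx /spun_dy /rotate_x /rotate_y /=.
  have -> : 2 * p = p + p by ring.
  by rewrite cosD sinD; congr pair; ring.
apply: (phaseE hl) => t.
by rewrite lerD2r.
Qed.

End SpunKnots.

(** * Paths in subspaces and change of base point *)

Section PathsInSubspaces.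
Variables (R : realType) (T : topologicalType).
Local Notation I := (unit_interval R).

(** An initial segment of the path joins its origin to any of its points. *)
Lemma path_component_path (x y : T) (p : path01 R x y) t : path_component R x (p t).
Proof.
pose r (u : I) := p (clamp (ival u * ival t)).
have cr : continuous r by rewrite /r; move: (ival t) => c; cts.
have r0 : r zero = x by rewrite /r ival0 mul0r clamp_le0// path_zero.
have r1 : r one = p t by rewrite /r ival1 mul1r ivalK.
exact: (inhabits (mk_path cr r0 r1 : path01 R x (p t))).
Qed.

Lemma path_in_subset (A : set T) (x y : set_type A)
  (p : path01 R (set_val x) (set_val y)) : (forall t, A (p t)) ->
  exists q : path01 R x y, forall t, set_val (q t) = p t.
Proof.
move=> Ap; pose q (t : I) : set_type A := exist _ (p t) (mem_set (Ap t)).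
have cq : continuous q by apply: continuous_comp_initial; exact: cts_fun.
have q0 : q zero = x by apply: val_inj; rewrite /= path_zero.
have q1 : q one = y by apply: val_inj; rewrite /= path_one.
by exists (mk_path cq q0 q1 : path01 R x y).
Qed.

End PathsInSubspaces.

Section Conjugation.
Variables (R : realType) (T : topologicalType).

Definition conj_path (x y : T) (q : path01 R x y) (p : path01 R x x) : path01 R y y :=
  concat (reverse q) (concat p q).

Lemma conj_null (x y : T) (q : path01 R x y) (p : path01 R x x) :
  homotopic p (const_path R x) -> homotopic (conj_path q p) (const_path R y).
Proof.
move=> p1; apply: homotopic_trans (reverse_concat q).
apply: homotopic_concat; first exact: homotopic_refl.
apply: homotopic_trans (const_concat q).
by apply: homotopic_concat => //; exact: homotopic_refl.
Qed.

(** q (q^-1 p q) q^-1 is homotopic to p. *)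
Lemma null_conj (x y : T) (q : path01 R x y) (p : path01 R x x) :
  homotopic (conj_path q p) (const_path R y) -> homotopic p (const_path R x).
Proof.
move=> c1.
have h1 : homotopic (concat q (concat (conj_path q p) (reverse q))) (const_path R x).
  apply: homotopic_trans (concat_reverse q).
  apply: homotopic_concat; first exact: homotopic_refl.
  apply: homotopic_trans (const_concat _).
  by apply: homotopic_concat => //; exact: homotopic_refl.
apply: homotopic_trans h1; apply: homotopic_sym.
have refl := homotopic_refl.
(* q ((q^-1 (p q)) q^-1) is reassociated to (q q^-1) (p (q q^-1)). *)
have h2 : homotopic (concat (conj_path q p) (reverse q))
    (concat (reverse q) (concat p (concat q (reverse q)))).
  apply: homotopic_trans (homotopic_sym (concatA _ _ _)) _.
  apply: homotopic_concat => //; exact: homotopic_sym (concatA _ _ _).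
apply: homotopic_trans (homotopic_concat (refl _ _ _ _ q) h2) _.
apply: homotopic_trans (concatA _ _ _) _.
apply: homotopic_trans (homotopic_concat (concat_reverse q)
  (homotopic_concat (refl _ _ _ _ p) (concat_reverse q))) _.
apply: homotopic_trans (const_concat _) _.
exact: concat_const.
Qed.

End Conjugation.

Lemma path_image_conj (R : realType) (T U : topologicalType) (f : continuousType T U)
  (x y : T) (q : path01 R x y) (p : path01 R x x) :
  path_image f (conj_path q p) = conj_path (path_image f q) (path_image f p).
Proof.
apply/path_eqP => t; rewrite /= /mk_path /concat_fun /=.
case: ifP => // _; rewrite /mk_path /concat_fun.
by case: ifP.
Qed.

(** * The spinning loop and its smooth contraction *)

Section SpinningLoop.
Variable R : realType.
Local Notation I := (unit_interval R).

Definition quat_angle (p : I * I) : R := 2 * pi * ival p.1.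
Definition quat_radius (p : I * I) : R := 1 - ival p.2.

(** For radius 1 and angle A the quaternion is cos A + k sin A. As the radius
    decreases to 0, this circle shrinks to its point 1 without meeting 0: the
    real part vanishes on the way, but the i-coordinate d then moves the
    quaternion off the plane of 1 and k. Leaving the unit sphere keeps the
    coordinates polynomial in the radius. *)
Definition quat_a p : R := 1 - quat_radius p * quat_radius p * (1 - cos (quat_angle p)).
Definition quat_b p : R := quat_radius p * sin (quat_angle p).
Definition quat_d p : R :=
  quat_radius p * (1 - quat_radius p) * (1 - cos (quat_angle p)).

(** If the i-coordinate vanishes, then r = 0 or cos A = 1, and the real part
    is 1; or r = 1, and the quaternion is cos A + k sin A. *)
Lemma quat_neq0 p :
  quat_a p * quat_a p + quat_b p * quat_b p + quat_d p * quat_d p != 0.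
Proof.
rewrite /quat_a /quat_b /quat_d; move: (quat_radius p) (quat_angle p) => r t.
have cs := cos2Dsin2 t; rewrite -!expr2 !paddr_eq0 ?addr_ge0 ?sqr_ge0// !sqrf_eq0.
apply/negP => /andP[/andP[/eqP a0 /eqP b0] /eqP d0].
have r1 : r = 1.
  have : (1 - r) * (r * r * (1 - cos t)) = 0.
    by transitivity (r * (r * (1 - r) * (1 - cos t))); [ring|rewrite d0 mulr0].
  move=> /eqP; rewrite mulf_eq0 => /orP[/eqP|/eqP]; lra.
move: a0 b0; rewrite r1 !mul1r => a0 s0.
move: cs; rewrite s0 expr0n addr0 /=.
have -> : cos t = 0 by lra.
by rewrite expr0n /= => /eqP; rewrite eq_sym oner_eq0.
Qed.

(** At the second coordinate zero these are the rotations by the angles from 0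
    to 4 pi of the Legendrian curve; the second coordinate is the time of the
    contraction. *)
Definition spin p : embedding R := Embedding (is_embedding_spun (quat_neq0 p)).

Lemma spin_continuous : continuous spin.
Proof.
have cc : continuous (@cos R) by exact: continuous_cos.
have cs : continuous (@sin R) by exact: continuous_sin.
have cq : continuous quat_angle by rewrite /quat_angle; cts.
have cr : continuous quat_radius by rewrite /quat_radius; cts.
apply: embedding_family_continuous => n i.
by apply: (@Cn_family_spun R _ quat_a quat_b quat_d);
  [rewrite /quat_a|rewrite /quat_b|rewrite /quat_d]; cts.
Qed.

Lemma spin_eq p q : quat_a p = quat_a q -> quat_b p = quat_b q ->
  quat_d p = quat_d q -> spin p = spin q.
Proof.
rewrite /spin => ea eb ed; move: (quat_neq0 p) (quat_neq0 q); rewrite ea eb ed => h h'.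
by rewrite (Prop_irrelevance h h').
Qed.

Lemma quat_unit p : quat_radius p = 0 \/ cos (quat_angle p) = 1 /\ sin (quat_angle p) = 0 ->
  [/\ quat_a p = 1, quat_b p = 0 & quat_d p = 0].
Proof.
rewrite /quat_a /quat_b /quat_d => -[->|[-> ->]].
  by rewrite !mul0r subr0.
by rewrite subrr !mulr0 subr0.
Qed.

(** The quaternion is 1 on three sides of the square. *)
Lemma spin_on_sides p q : quat_radius p = 0 \/ ival p.1 = 0 \/ ival p.1 = 1 ->
  quat_radius q = 0 \/ ival q.1 = 0 \/ ival q.1 = 1 -> spin p = spin q.
Proof.
have one_of u : quat_radius u = 0 \/ ival u.1 = 0 \/ ival u.1 = 1 ->
    [/\ quat_a u = 1, quat_b u = 0 & quat_d u = 0].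
  move=> h; apply: quat_unit; move: h; rewrite /quat_angle => -[->|[->|->]]; first by left.
    by right; rewrite mulr0 cos0 sin0.
  by right; rewrite mulr1 mulr_natl cos2pi sin2pi.
move=> /one_of[a b d] /one_of[a' b' d'].
by apply: spin_eq; rewrite ?a ?b ?d ?a' ?b' ?d'.
Qed.

Lemma spin_zero s : spin (zero, s) = spin (zero, zero).
Proof. by apply: spin_on_sides; rewrite /= ival0; right; left. Qed.

Lemma spin_one s : spin (one, s) = spin (zero, zero).
Proof. by apply: spin_on_sides; rewrite /= ?ival0 ?ival1; right; [right|left]. Qed.

Lemma spin_const t : spin (t, one) = spin (zero, zero).
Proof.
apply: spin_on_sides; first by left; rewrite /quat_radius /= ival1 subrr.
by right; left; rewrite /= ival0.
Qed.

Lemma quat_rotation t : [/\ quat_a (t, zero) = cos (2 * pi * ival t),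
  quat_b (t, zero) = sin (2 * pi * ival t) & quat_d (t, zero) = 0].
Proof.
rewrite /quat_a /quat_b /quat_d /quat_angle /quat_radius /= ival0 subr0.
by rewrite subrr !mul1r mul0r subKr.
Qed.

Lemma spin_planar t : exists h : is_embedding
    (spun (cos (2 * pi * ival t)) (sin (2 * pi * ival t)) 0),
  spin (t, zero) = Embedding h.
Proof.
have [a b d] := quat_rotation t; rewrite /spin; move: (is_embedding_spun _).
by rewrite a b d => h; exists h.
Qed.

Lemma spin_legendrian t : is_legendrian (spin (t, zero)).
Proof.
have [h ->] := spin_planar t; apply: is_legendrian_spun.
by rewrite -!expr2 cos2Dsin2.
Qed.

Lemma spin_phase : exists m : R, forall t,
  phase (spin (t, zero)) = unit_vector (m + 4 * pi * ival t).
Proof.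
have [m hm] := spun_phase R; exists m => t.
have [h ->] := spin_planar t; rewrite hm.
by congr (unit_vector (_ + _)); ring.
Qed.

End SpinningLoop.

Lemma phase_unit (R : realType) (f : embedding R) : exists a, phase f = unit_vector a.
Proof.
have [[theta ft]|nf] := pselect (exists theta, direction_lift f theta).
  by have [m tm] := direction_lift_minimum ft; exists (theta m); exact: phaseE.
by exists 0; rewrite (phase_noE nf) /unit_vector cos0 sin0.
Qed.

Lemma dot_unit_vector (R : realType) (a : R) : dot (unit_vector a) (unit_vector a) = 1.
Proof. by rewrite /dot /= -!expr2 cos2Dsin2. Qed.

(** * The two knot types *)

Section LegendrianLoop.
Variable R : realType.
Local Notation I := (unit_interval R).

Definition spin_knot (p : I * I) : knot R := knot_of (spin p).

Lemma spin_knot_continuous : continuous spin_knot.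
Proof. exact: (continuous_comp2 (@knot_of_continuous R) (@spin_continuous R)). Qed.

Lemma spin_knot_legendrian t : legendrian (spin_knot (t, zero)).
Proof. by exists (spin (t, zero)) => //; exact: spin_legendrian. Qed.

Definition spin_legendrian_knot (t : I) : legendrian_knot R :=
  exist _ (spin_knot (t, zero)) (mem_set (spin_knot_legendrian t)).

Definition base_knot : legendrian_knot R := spin_legendrian_knot zero.

Lemma spin_legendrian_knot_continuous : continuous spin_legendrian_knot.
Proof.
apply: continuous_comp_initial.
have c : continuous (fun t : I => (t, zero : I)).
  by apply: continuous_pair; [exact: continuous_idfun|exact: cst_continuous].
exact: (continuous_comp2 spin_knot_continuous c).
Qed.

Lemma spin_legendrian_knot_one : spin_legendrian_knot one = base_knot.
Proof. by apply: val_inj; rewrite /= /spin_knot spin_one. Qed.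

Definition spin_loop : path01 R base_knot base_knot :=
  mk_path spin_legendrian_knot_continuous erefl spin_legendrian_knot_one.

Definition legendrian_component : set (legendrian_knot R) := path_component R base_knot.

Definition smooth_component : set (knot R) := path_component R (set_val base_knot).

Lemma set_val_legendrian_continuous :
  continuous (set_val : legendrian_knot R -> knot R).
Proof. exact: initial_continuous. Qed.

Lemma legendrian_component_smooth (l : legendrian_knot R) :
  legendrian_component l -> smooth_component (set_val l).
Proof.
move=> [p].
have c : continuous (fun t => set_val (p t)).
  exact: (continuous_comp2 set_val_legendrian_continuous (@cts_fun _ _ p)).
have p0 : set_val (p zero) = set_val base_knot by rewrite path_zero.
have p1 : set_val (p one) = set_val l by rewrite path_one.
exact: (inhabits (mk_path c p0 p1 : path01 R (set_val base_knot) (set_val l))).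
Qed.

Lemma base_in_component : legendrian_component base_knot.
Proof. exact: (inhabits (const_path R base_knot)). Qed.

Definition component_base : set_type legendrian_component :=
  exist _ base_knot (mem_set base_in_component).

Lemma spin_knot_smooth_component p : smooth_component (spin_knot p).
Proof.
case: p => t s; pose r (u : I) := spin_knot (u, s).
have cr : continuous r.
  apply: (continuous_comp2 spin_knot_continuous).
  by apply: continuous_pair; [exact: continuous_idfun|exact: cst_continuous].
have r0 : r zero = set_val base_knot by rewrite /r /spin_knot spin_zero.
have r1 : r one = set_val base_knot by rewrite /r /spin_knot spin_one.
exact: (path_component_path (mk_path cr r0 r1 : path01 R _ _) t).
Qed.

Lemma component_loop : exists q : path01 R component_base component_base,
  forall t, set_val (q t) = spin_legendrian_knot t.
Proof.
apply: (@path_in_subset _ _ legendrian_component component_base component_base spin_loop) => t.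
exact: (path_component_path spin_loop).
Qed.

(** The contraction of the loop of quaternions moves the curve through smooth
    knots that need not be Legendrian. *)
Lemma loop_null_homotopic (q : path01 R component_base component_base) :
  (forall t, set_val (q t) = spin_legendrian_knot t) ->
  homotopic (path_image (inclusion legendrian_component_smooth) q)
    (const_path R (inclusion legendrian_component_smooth component_base)).
Proof.
move=> qE; pose h (p : I * I) : set_type smooth_component :=
  exist _ (spin_knot p) (mem_set (spin_knot_smooth_component p)).
exists h; split=> [|t|t|s].
- by apply: continuous_comp_initial; exact: spin_knot_continuous.
- by apply: val_inj; rewrite /= qE.
- by apply: val_inj; rewrite /= /spin_knot spin_const.
- by split; apply: val_inj; rewrite /= /spin_knot ?spin_zero ?spin_one.
Qed.

(** The phase of the rotated curve goes twice around the circle, whereas a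
    contraction through Legendrian knots would give the loop of phases a
    periodic angle. *)
Lemma loop_essential (q : path01 R component_base component_base) :
  (forall t, set_val (q t) = spin_legendrian_knot t) ->
  ~ homotopic q (const_path R component_base).
Proof.
move=> qE /homotopic_sym [h [ch h0 h1 he]].
pose G (p : I * I) : R * R := knot_phase (set_val (set_val (h p))).
have cG : continuous G.
  apply: (continuous_comp2 (@knot_phase_continuous R)).
  by apply: continuous_comp2 ch; exact: initial_continuous.
have unitG p : exists a, G p = unit_vector a by exact: phase_unit.
have [m hm] := spin_phase R.
have [theta] : exists theta, angle_lift (@ends R) (fun t => G (t, one)) theta.
  apply: homotopic_angle_lift => [//|p|s|].
  - by have [a ->] := unitG p; rewrite dot_unit_vector.
  - by rewrite /G (he s).1 (he s).2.
  - have [a aE] := unitG (zero, zero); exists (fun=> a); split=> [|//|t].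
      exact: continuous_cst0.
    have -> : G (t, zero) = unit_vector a by rewrite -aE /G !h0.
    by exists 1; rewrite ?ltr01// !mul1r.
have -> : (fun t => G (t, one)) = (fun t => unit_vector (m + 4 * pi * ival t)).
  by apply/funext => t; rewrite /G h1 qE -hm; exact: knot_phaseE.
apply: turning_no_angle_lift.
by rewrite mulf_neq0// ?pnatr_eq0// gt_eqF// pi_gt0.
Qed.

End LegendrianLoop.

Theorem corollary1p3 (R : realType) :
  exists (L : set (legendrian_knot R)) (K : set (knot R))
    (LK : forall l, L l -> K (set_val l)),
    [/\ is_path_component R L, is_path_component R K &
      forall x : set_type L,
        ~ injective (pi1_map R (inclusion LK) x)].
Proof.
exists (@legendrian_component R), (@smooth_component R), (@legendrian_component_smooth R); split.
- by exists (base_knot R).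
- by exists (set_val (base_knot R)).
move=> x inj.
have [p] := set_valP x.
have [q _] : exists q : path01 R (component_base R) x, forall t, set_val (q t) = p t.
  by apply: path_in_subset => t; exact: path_component_path.
have [g gE] := component_loop R.
apply: (loop_essential gE); apply: (@null_conj _ _ _ _ q).
apply/pi1_classP; apply: inj; rewrite !pi1_mapE; apply/pi1_classP.
rewrite path_image_conj.
apply: (homotopic_trans (conj_null _ (loop_null_homotopic gE))).
have -> : path_image (inclusion (@legendrian_component_smooth R)) (const_path R x) =
    const_path R (inclusion (@legendrian_component_smooth R) x) by exact/path_eqP.
exact: homotopic_refl.
Qed.
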